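(* Let $\alpha<-2$ and $\beta>2$ be real numbers and let $\lambda(\alpha,\beta)$ be the Lyapunov exponent of the random product $M_N$ of the two shear matrices $A,B$ (as defined in the context). Put $$\Gamma=-\frac{\beta}{2}+\sqrt{\left(\frac{\beta}{2}\right)^2+\frac{\beta}{\alpha}},\qquad\Gamma_{m_a,m_b}=\frac{\Gamma+m_b\beta}{m_a\alpha\Gamma+m_am_b\alpha\beta+1}\quad(m_a,m_b\in\{1,2\})$$ (note that $\Gamma_{1,1}=\Gamma$), and, for integers $a,b\ge1$, $$\hat{\tilde\phi}_1^{(m_a,m_b)}(a,b,\alpha,\beta)=\tfrac{1}{1-\Gamma_{m_a,m_b}}\left(b\beta+\Gamma_{m_a,m_b}-a\alpha b\beta-1-a\alpha\Gamma_{m_a,m_b}\right),$$ $$\hat{\tilde\phi}_2^{(m_a,m_b)}(a,b,\alpha,\beta)=\left(\tfrac{1}{1+\Gamma_{m_a,m_b}^2}\left((\Gamma_{m_a,m_b}+b\beta)^2+(1+a\alpha\Gamma_{m_a,m_b}+a\alpha b\beta)^2\right)\right)^{1/2},$$ $$\hat{\tilde\phi}_\infty^{(m_a,m_b)}(a,b,\alpha,\beta)=-a\alpha b\beta-a\alpha\Gamma_{m_a,m_b}-1,$$ $$\hat{\tilde\psi}_\infty^{(1)}(a,b,\alpha,\beta)=-a\alpha b\beta-1-\frac{a\alpha\beta}{1+\alpha\beta},\qquad\hat{\tilde\psi}_\infty^{(2)}(a,b,\alpha,\beta)=-a\alpha b\beta-1-a,$$ $$\hat{\tilde\psi}_\infty^{(3)}(a,b,\alpha,\beta)=\hat{\tilde\psi}_\infty^{(4)}(a,b,\alpha,\beta)=-a\alpha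 b\beta-1.$$ Let $$\hat{\tilde{\mathcal{L}}}_k(\alpha,\beta)=\sum_{a,b=1}^\infty2^{-a-b}\log\left(\frac14\sum_{m_a,m_b=1}^2\hat{\tilde\phi}_k^{(m_a,m_b)}(a,b,\alpha,\beta)\right)\quad(k\in\{1,2,\infty\}),$$ $$\hat{\tilde{\mathcal{U}}}_\infty(\alpha,\beta)=\sum_{a,b=1}^\infty2^{-a-b}\log\left(\frac14\sum_{m=1}^4\hat{\tilde\psi}_\infty^{(m)}(a,b,\alpha,\beta)\right).$$ Then $$\max_{k\in\{1,2,\infty\}}\hat{\tilde{\mathcal{L}}}_k(\alpha,\beta)\le4\lambda(\alpha,\beta)\le\hat{\tilde{\mathcal{U}}}_\infty(\alpha,\beta).$$
   Context: For real $\alpha,\beta$ let $A=\begin{pmatrix}1&0\\ \alpha&1\end{pmatrix}$ and $B=\begin{pmatrix}1&\beta\\0&1\end{pmatrix}$. Let $M_N=\prod_{k=1}^N A_{i_k}$ be the random product in which the $N$ factors are i.i.d., each equal to $A_1=A$ or $A_2=B$ with probability $1/2$. The Lyapunov exponent is $\lambda(\alpha,\beta)=\lim_{N\to\infty}\frac1N\,\mathbb{E}\log\|M_N\|$ (independent of the matrix norm), equivalently $\lim_{N\to\infty}\frac1N\,\mathbb{E}\log\|M_NX_0\|$ for an arbitrary nonzero vector $X_0\in\mathbb{R}^2$ and any vector norm. The logarithm is natural. *)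

(* Defs.v *)
From HB Require Import structures.
From mathcomp Require Import all_boot all_order all_algebra.
From mathcomp Require Import all_classical all_reals all_analysis.
Set Implicit Arguments.
Unset Strict Implicit.
Unset Printing Implicit Defensive.
Import Order.TTheory GRing.Theory Num.Theory.
Import numFieldNormedType.Exports.
Local Open Scope classical_set_scope.
Local Open Scope ring_scope.

Section RandomProduct.
Context {d : measure_display} {T : measurableType d} {R : realType}.
Context {P : probability T R}.

Definition mutually_independent {d' : measure_display} {T' : measurableType d'}
    (X : nat -> {RV P >-> T'}) : Prop :=
  forall (s : seq nat) (E : nat -> set T'), uniq s ->
    (forall k, measurable (E k)) ->
    P (\bigcap_(k in [set` s]) (X k @^-1` E k)) =
    (\prod_(k <- s) P (X k @^-1` E k))%E.

Definition iid_fair_bits (i : nat -> {RV P >-> bool}) : Prop :=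
  mutually_independent i /\
  forall k (c : bool), P (i k @^-1` [set c]) = (2^-1)%:E.

Definition shearA (alpha : R) : 'M[R]_2 := 1%:M + alpha *: delta_mx 1 0.
Definition shearB (beta : R) : 'M[R]_2 := 1%:M + beta *: delta_mx 0 1.

(* [M_N = A_{i_0} *m ... *m A_{i_(N-1)}], with [true] selecting [A]. *)
Definition random_product (i : nat -> {RV P >-> bool}) (alpha beta : R)
    (N : nat) (w : T) : 'M[R]_2 :=
  \prod_(k < N) (if i k w then shearA alpha else shearB beta).

(* The norm is the library's norm on matrices (largest absolute value of an
   entry); the limit does not depend on the choice of norm.  The integrand is
   bounded for each [N], so [fine] loses nothing. *)
Definition lyapunov (i : nat -> {RV P >-> bool}) (alpha beta : R) : R :=
  limn (fun N : nat =>
    N%:R^-1 * fine 'E_P[fun w => ln `|random_product i alpha beta N w|]).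

End RandomProduct.

Section Bounds.
Context {R : realType}.
Implicit Types (alpha beta : R) (ma mb a b m : nat).

Definition Gamma alpha beta : R :=
  - (beta / 2) + Num.sqrt ((beta / 2) ^+ 2 + beta / alpha).

Definition Gamma_ ma mb alpha beta : R :=
  (Gamma alpha beta + mb%:R * beta) /
  (ma%:R * alpha * Gamma alpha beta + ma%:R * mb%:R * alpha * beta + 1).

Definition phi1 ma mb a b alpha beta : R :=
  let g := Gamma_ ma mb alpha beta in
  (1 - g)^-1 * (b%:R * beta + g - a%:R * alpha * b%:R * beta - 1
                - a%:R * alpha * g).

Definition phi2 ma mb a b alpha beta : R :=
  let g := Gamma_ ma mb alpha beta in
  Num.sqrt ((1 + g ^+ 2)^-1 *
    ((g + b%:R * beta) ^+ 2 +
     (1 + a%:R * alpha * g + a%:R * alpha * b%:R * beta) ^+ 2)).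

Definition phioo ma mb a b alpha beta : R :=
  - (a%:R * alpha * b%:R * beta) - a%:R * alpha * Gamma_ ma mb alpha beta - 1.

Definition psioo m a b alpha beta : R :=
  match m with
  | 1 => - (a%:R * alpha * b%:R * beta) - 1
         - a%:R * alpha * beta / (1 + alpha * beta)
  | 2 => - (a%:R * alpha * b%:R * beta) - 1 - a%:R
  | _ => - (a%:R * alpha * b%:R * beta) - 1
  end.

Definition log_series (f : nat -> nat -> R) : R :=
  \big[+%R/0]_(1 <= a <oo) \big[+%R/0]_(1 <= b <oo)
    (2^-1 ^+ (a + b) * ln (f a b)).

Definition Lbound (phi : nat -> nat -> nat -> nat -> R -> R -> R)
    alpha beta : R :=
  log_series (fun a b =>
    4^-1 * \sum_(1 <= ma < 3) \sum_(1 <= mb < 3) phi ma mb a b alpha beta).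

Definition Uboundoo alpha beta : R :=
  log_series (fun a b => 4^-1 * \sum_(1 <= m < 5) psioo m a b alpha beta).

End Bounds.

(* Main.v *)
(** Put [s = - alpha] and [k = s beta > 4].  The direction [omega = s x / y] of a
    vector becomes [omega + k] under [B] and [omega / (1 - omega)] under [A], so
    the dynamics depends on [k] only.  Reading a word from its right end, a block
    [A^a B^b] maps a direction [- eta], with [0 < eta <= e] and
    [e = alpha Gamma], to [- blockmap k a b eta] and multiplies the norm by
    [Phi a b eta].  At a given position a block with parameters [a], [b] is
    completed with probability [2^-(a+b) / 4], so [4 lambda] is the average with
    weights [2^-(a+b)] of [E ln (Phi a b eta)], where [eta] is the random direction
    before the block.

    Upper bound: the first two letters bound [eta] below on events of total
    probability 1, and Jensen's inequality applies.

    Lower bound: Jensen's inequality goes the wrong way for the logarithm of the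
    mean of [Phi] over the four points [- s Gamma_m].  The first four letters give
    a law on 16 points that bounds [eta] above and is better than the uniform law
    on these four points by enough to compensate for the concavity of [ln].  By
    the Cauchy-Schwarz inequality the comparison splits into three inequalities
    about [k - 1 - eta], [1 + eta / 2] and [4 + eta ^ 2]; with [x = e - 1] and
    [k = (1 + x)^2 / x] they are rational inequalities on [0 < x <= 1], verified
    by computation. *)

Require Import Defs.
From Stdlib Require Import ZArith.
From HB Require Import structures.
From mathcomp Require Import all_boot all_order all_algebra.
From mathcomp Require Import all_classical all_reals all_analysis.
From mathcomp Require Import ssrZ zify ring lra.
Set Implicit Arguments.
Unset Strict Implicit.
Unset Printing Implicit Defensive.
Import Order.TTheory GRing.Theory Num.Theory.
Import numFieldNormedType.Exports.
Local Open Scope classical_set_scope.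
Local Open Scope ring_scope.

(** * Rational inequalities by computation *)

(** No stationary measure occurs: everything is an exact average over the [2^n] words of length [n].
    The leftmost letter is applied last, so the first letters of a word bound its direction whatever
    follows, and conditioning on them gives finite recursions for the expected growth. A block cut
    off by the end of the word has no usable law of directions. From below its gain is dropped,
    being nonnegative; from above it is estimated crudely with an exponentially small weight, at a
    total cost independent of [n].

    The computation can treat only one of the parameters [alpha], [beta], [a], [b], so the three
    inequalities are certified at extreme values only. A block multiplies [y], up to sign, by
    [a (K - eta)] with [K = b k - 1 / a], and [k - 1] is the least such [K]; [1 + eta / 2] and
    [4 + eta ^ 2] belong to the sum norm and the Euclidean norm at the limiting value [s = 2].
    Tangent inequalities then carry them to larger [K] and larger [s]. The parameter [x] avoids the
    square root in [e] as a function of [k]. *)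

Inductive rexp :=
  | RX | RC of nat
  | RAdd of rexp & rexp | RSub of rexp & rexp
  | RMul of rexp & rexp | RDiv of rexp & rexp.

Fixpoint reval (R : realFieldType) (x : R) (e : rexp) : R :=
  match e with
  | RX => x
  | RC n => n%:R
  | RAdd a b => reval x a + reval x b
  | RSub a b => reval x a - reval x b
  | RMul a b => reval x a * reval x b
  | RDiv a b => reval x a / reval x b
  end.

Definition rpow (e : rexp) (n : nat) : rexp := iter n (RMul e) (RC 1).

Fixpoint padd (p q : seq Z) : seq Z :=
  match p, q with
  | [::], _ => q
  | _, [::] => p
  | a :: p', b :: q' => Z.add a b :: padd p' q'
  end.

Definition pscale (c : Z) (p : seq Z) : seq Z := [seq Z.mul c a | a <- p].

Fixpoint pmul (p q : seq Z) : seq Z :=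
  if p is a :: p' then padd (pscale a q) (Z.zero :: pmul p' q) else [::].

Definition psub (p q : seq Z) : seq Z := padd p (pscale (Z.opp Z.one) q).

(* On [0, 1] one has [c + x q(x) >= c + min 0 (inf q)]. *)
Definition plo (p : seq Z) : Z := foldr (fun c r => Z.add c (Z.min Z.zero r)) Z.zero p.

(** The result is a numerator and a denominator, constant coefficient first. A division is accepted
    only if [plo] certifies the numerator of the divisor, so denominators stay positive on [[0, 1]]
    and the numerator carries the sign. Only syntactically equal denominators are merged, which
    limits the degrees. *)
Fixpoint rnorm (e : rexp) : option (seq Z * seq Z) :=
  match e with
  | RX => Some ([:: Z.zero; Z.one], [:: Z.one])
  | RC n => Some ([:: Z.of_nat n], [:: Z.one])
  | RAdd a b =>
      if (rnorm a, rnorm b) is (Some (p, q), Some (p', q')) then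
        if q == q' then Some (padd p p', q)
        else Some (padd (pmul p q') (pmul p' q), pmul q q')
      else None
  | RSub a b =>
      if (rnorm a, rnorm b) is (Some (p, q), Some (p', q')) then
        if q == q' then Some (psub p p', q)
        else Some (psub (pmul p q') (pmul p' q), pmul q q')
      else None
  | RMul a b =>
      if (rnorm a, rnorm b) is (Some (p, q), Some (p', q'))
      then Some (pmul p p', pmul q q') else None
  | RDiv a b =>
      if (rnorm a, rnorm b) is (Some (p, q), Some (p', q')) then
        if Z.ltb Z.zero (plo p') then
          if q == q' then Some (p, p') else Some (pmul p q', pmul q p')
        else None
      else None
  end.

Definition rnonneg (e : rexp) : bool :=
  if rnorm e is Some (p, _) then Z.leb Z.zero (plo p) else false.

Section Soundness.
Variables (R : realFieldType) (x : R).
Hypotheses (x0 : 0 <= x) (x1 : x <= 1).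

Let zr (z : Z) : R := (int_of_Z z)%:~R.

Let zrD a b : zr (Z.add a b) = zr a + zr b.
Proof. by rewrite /zr (_ : Z.add a b = a + b) // !rmorphD. Qed.

Let zrM a b : zr (Z.mul a b) = zr a * zr b.
Proof. by rewrite /zr (_ : Z.mul a b = a * b) // !rmorphM. Qed.

Let zr_le a b : Z.le a b -> zr a <= zr b.
Proof. by move=> ab; rewrite /zr ler_int; lia. Qed.

Let zr_lt a b : Z.lt a b -> zr a < zr b.
Proof. by move=> ab; rewrite /zr ltr_int; lia. Qed.

Definition peval (p : seq Z) : R := foldr (fun c r => zr c + x * r) 0 p.

Lemma peval_add p q : peval (padd p q) = peval p + peval q.
Proof.
elim: p q => [|a p IH] [|b q] //=; rewrite ?add0r ?addr0 //.
by rewrite zrD IH; ring.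
Qed.

Lemma peval_scale c p : peval (pscale c p) = zr c * peval p.
Proof. by elim: p => [|a p IH] /=; rewrite ?mulr0 // zrM IH; ring. Qed.

Lemma peval_mul p q : peval (pmul p q) = peval p * peval q.
Proof.
elim: p => [|a p IH] /=; first by rewrite mul0r.
by rewrite peval_add peval_scale /= IH (_ : zr Z.zero = 0) //; ring.
Qed.

Lemma peval_sub p q : peval (psub p q) = peval p - peval q.
Proof. by rewrite peval_add peval_scale (_ : zr (Z.opp Z.one) = -1) // mulN1r. Qed.

Lemma plo_le p : zr (plo p) <= peval p.
Proof.
elim: p => [//|a p IH] /=; rewrite zrD lerD2l.
have [h|h] : Z.min Z.zero (plo p) = Z.zero /\ Z.le Z.zero (plo p) \/
    Z.min Z.zero (plo p) = plo p /\ Z.le (plo p) Z.zero by lia.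
  case: h => -> /zr_le h; apply: mulr_ge0 => //; exact: (le_trans h IH).
(* For [plo p <= 0], [x * plo p >= plo p] because [x <= 1]. *)
case: h => -> /zr_le h; have /= h1 : 0 <= (1 - x) * - zr (plo p).
  by apply: mulr_ge0; rewrite ?subr_ge0 // oppr_ge0.
apply: (le_trans _ (ler_wpM2l x0 IH)).
by move: h1; rewrite mulrBl mul1r mulrN opprK addrC subr_ge0.
Qed.

Lemma rnormP e p q : rnorm e = Some (p, q) ->
  0 < peval q /\ reval x e = peval p / peval q.
Proof.
have z1 : zr Z.one = 1 by [].
have z0 : zr Z.zero = 0 by [].
elim: e p q => [|n|a IHa b IHb|a IHa b IHb|a IHa b IHb|a IHa b IHb] p q /=.
- move=> [<- <-] /=; rewrite z0 z1 !mulr0 !addr0 add0r mulr1.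
  by rewrite ltr01 divr1.
- move=> [<- <-] /=; rewrite z1 !mulr0 !addr0 ltr01 divr1; split=> //.
  rewrite /zr (_ : Z.of_nat n = Z_of_int n%:Z) // Z_of_intK.
  by rewrite pmulrn.
- case: (rnorm a) IHa => [[pa qa]|//] /(_ _ _ erefl) [qa0 ->].
  case: (rnorm b) IHb => [[pb qb]|//] /(_ _ _ erefl) [qb0 ->].
  have ? := lt0r_neq0 qa0; have ? := lt0r_neq0 qb0.
  case: eqP => [->|_] [<- <-]; rewrite !peval_add ?peval_mul.
    by rewrite mulrDl.
  by split; [exact: mulr_gt0|field; apply/andP].
- case: (rnorm a) IHa => [[pa qa]|//] /(_ _ _ erefl) [qa0 ->].
  case: (rnorm b) IHb => [[pb qb]|//] /(_ _ _ erefl) [qb0 ->].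
  have ? := lt0r_neq0 qa0; have ? := lt0r_neq0 qb0.
  case: eqP => [->|_] [<- <-]; rewrite !peval_sub ?peval_mul.
    by rewrite mulrBl.
  by split; [exact: mulr_gt0|field; apply/andP].
- case: (rnorm a) IHa => [[pa qa]|//] /(_ _ _ erefl) [qa0 ->].
  case: (rnorm b) IHb => [[pb qb]|//] /(_ _ _ erefl) [qb0 ->].
  have ? := lt0r_neq0 qa0; have ? := lt0r_neq0 qb0.
  move=> [<- <-]; rewrite !peval_mul.
  by split; [exact: mulr_gt0|field; apply/andP].
- case: (rnorm a) IHa => [[pa qa]|//] /(_ _ _ erefl) [qa0 ->].
  case: (rnorm b) IHb => [[pb qb]|//] /(_ _ _ erefl) [qb0 ->].
  have ? := lt0r_neq0 qa0; have ? := lt0r_neq0 qb0.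
  case: ifP => // /Z.ltb_lt/zr_lt pb0.
  have {}pb0 : 0 < peval pb by apply: lt_le_trans (plo_le pb).
  have ? := lt0r_neq0 pb0.
  case: eqP => [->|_] [<- <-]; rewrite ?peval_mul; split=> //.
  + by field; apply/andP.
  + exact: mulr_gt0.
  + by field; apply/and3P.
Qed.

Lemma rnonnegP e : rnonneg e -> 0 <= reval x e.
Proof.
rewrite /rnonneg; case E: (rnorm e) => [[p q]|//] /Z.leb_le/zr_le h.
have [q0 ->] := rnormP E.
by rewrite divr_ge0 ?(ltW q0) //; exact: (le_trans h (plo_le p)).
Qed.

End Soundness.

(** * Certificates for the three inequalities in [x = e - 1] *)

Section Certificates.

(* The block map [blockmap k a b] for [k = (1 + x)^2 / x]; numerator and
   denominator are multiplied by [x]. *)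
Definition rblockmap (a b : nat) (e : rexp) : rexp :=
  let w := RSub (RMul (RC b) (rpow (RAdd (RC 1) RX) 2)) (RMul RX e) in
  RDiv w (RSub (RMul (RC a) w) RX).

Definition rsum (s : seq rexp) : rexp := foldr RAdd (RC 0) s.
Definition rprod (s : seq rexp) : rexp := foldr RMul (RC 1) s.

(* Upper bounds for [eta_of k w], listed by the first four letters of [w] in
   lexicographic order with [true] first. *)
Definition leaves (U : Type) (F : nat -> nat -> U -> U) (e : U) : seq U :=
  [:: F 4 1 e; F 4 1 e; F 3 1 e; F 3 1 e;
      F 2 1 e; F 2 1 e; F 2 2 e; F 2 2 e;
      F 1 1 (F 2 1 e); F 1 1 (F 2 1 e); e; F 1 1 (F 1 2 e);
      F 1 2 e; F 1 2 e; F 1 3 e; F 1 3 e]%N.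

(* The points [alpha * Gamma_ ma mb] for [ma, mb <= 2], [e] being a fixed point of
   [F 1 1]. *)
Definition targets (U : Type) (F : nat -> nat -> U -> U) (e : U) : seq U :=
  [:: e; F 1 2 e; F 2 1 e; F 2 2 e]%N.

Definition rleaves := leaves rblockmap (RAdd (RC 1) RX).
Definition rtargets := targets rblockmap (RAdd (RC 1) RX).

Definition rgap (e : rexp) : rexp :=
  RSub (RAdd (RC 1) (RAdd RX (RMul RX RX))) (RMul RX e).

(** The factor [x] in [rgap] clears the denominator of [k]. Both sides have degree 16 in the gaps,
    so [x ^ 16] cancels; comparing 16 leaves with the eighth power of a mean square avoids the root
    mean square. *)
Definition cert_gap : rexp :=
  RSub (rprod [seq rgap e | e <- rleaves])
   (rpow (RDiv (rsum [seq rpow (rgap e) 2 | e <- rtargets]) (RC 4)) 8).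

(** For [sigma = 1 / 2] this says that the mean over the targets of [(1 + sigma t)^-2] is at most
    [(1 + sigma mu)^-2], with [mu] the mean of the leaves. The 4 is the number of targets. *)
Definition cert_norm1 : rexp :=
  RSub (RC 4)
   (RMul (rpow (RAdd (RC 2) (RDiv (rsum rleaves) (RC 16))) 2)
    (rsum [seq rpow (RDiv (RC 1) (RAdd (RC 2) e)) 2 | e <- rtargets])).

Definition cert_norm2 : rexp :=
  RSub (RC 4)
   (RMul (RAdd (RC 4) (RDiv (rsum [seq rpow e 2 | e <- rleaves]) (RC 16)))
    (rsum [seq RDiv (RC 1) (RAdd (RC 4) (rpow e 2)) | e <- rtargets])).

Variables (R : realFieldType) (x : R).
Hypotheses (x0 : 0 < x) (x1 : x <= 1).
Let k := (1 + x) ^+ 2 / x.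

Definition blockmap (k : R) (a b : nat) (eta : R) : R :=
  (b%:R * k - eta) / (a%:R * (b%:R * k - eta) - 1).

Lemma reval_rpow e n : reval x (rpow e n) = reval x e ^+ n.
Proof. by elim: n => [|n IH] /=; rewrite ?expr0 // exprS -IH. Qed.

Lemma reval_rblockmap a b e :
  reval x (rblockmap a b e) = blockmap k a b (reval x e).
Proof.
rewrite /rblockmap /blockmap; cbn [reval]; rewrite reval_rpow; cbn [reval].
have -> : b%:R * (1 + x) ^+ 2 - x * reval x e = x * (b%:R * k - reval x e).
  by rewrite /k; field; apply: lt0r_neq0.
set w := (b%:R * k - _).
have -> : a%:R * (x * w) - x = x * (a%:R * w - 1) by ring.
by rewrite -mulf_div divff ?mul1r // lt0r_neq0.
Qed.

Lemma reval_rsum s : reval x (rsum s) = \sum_(e <- s) reval x e.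
Proof. by elim: s => [|e s IH] /=; rewrite ?big_nil // big_cons IH. Qed.

Lemma reval_rprod s : reval x (rprod s) = \prod_(e <- s) reval x e.
Proof. by elim: s => [|e s IH] /=; rewrite ?big_nil // big_cons IH. Qed.

Lemma reval_leaves : [seq reval x e | e <- rleaves] = leaves (blockmap k) (1 + x).
Proof. by rewrite /rleaves /leaves /map !reval_rblockmap. Qed.

Lemma reval_targets :
  [seq reval x e | e <- rtargets] = targets (blockmap k) (1 + x).
Proof. by rewrite /rtargets /targets /map !reval_rblockmap. Qed.

Lemma reval_rgap e : reval x (rgap e) = x * (k - 1 - reval x e).
Proof. by rewrite /= /k; field; apply: lt0r_neq0. Qed.

Let x0' : 0 <= x. Proof. exact: ltW. Qed.

Lemma gap_inequality :
  ((\sum_(t <- targets (blockmap k) (1 + x)) (k - 1 - t) ^+ 2) / 4) ^+ 8 <=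
  \prod_(l <- leaves (blockmap k) (1 + x)) (k - 1 - l).
Proof.
have C : rnonneg cert_gap by vm_compute.
have := rnonnegP x0' x1 C.
rewrite {C} -reval_targets -reval_leaves !big_map /cert_gap; cbn [reval].
rewrite subr_ge0 reval_rpow; cbn [reval].
rewrite reval_rprod reval_rsum !big_map.
under eq_bigr do rewrite reval_rpow reval_rgap exprMn.
under [X in _ <= X -> _]eq_bigr do rewrite reval_rgap.
rewrite -mulr_sumr -mulrA exprMn -exprM big_split /=.
have -> : \prod_(e <- rleaves) x = x ^+ 16.
  by rewrite /rleaves /leaves !big_cons big_nil; ring.
by rewrite ler_pM2l // exprn_gt0.
Qed.

Lemma norm1_inequality :
  (2 + (\sum_(l <- leaves (blockmap k) (1 + x)) l) / 16) ^+ 2 *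
  (\sum_(t <- targets (blockmap k) (1 + x)) (1 / (2 + t)) ^+ 2) <= 4.
Proof.
have C : rnonneg cert_norm1 by vm_compute.
have := rnonnegP x0' x1 C.
rewrite {C} -reval_targets -reval_leaves !big_map /cert_norm1; cbn [reval].
rewrite subr_ge0 reval_rpow; cbn [reval]; rewrite !reval_rsum !big_map.
by under eq_bigr do rewrite reval_rpow.
Qed.

Lemma norm2_inequality :
  (4 + (\sum_(l <- leaves (blockmap k) (1 + x)) l ^+ 2) / 16) *
  (\sum_(t <- targets (blockmap k) (1 + x)) (1 / (4 + t ^+ 2))) <= 4.
Proof.
have C : rnonneg cert_norm2 by vm_compute.
have := rnonnegP x0' x1 C.
rewrite {C} -reval_targets -reval_leaves !big_map /cert_norm2; cbn [reval].
rewrite subr_ge0; cbn [reval]; rewrite !reval_rsum !big_map.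
under eq_bigr do rewrite reval_rpow.
by under [X in _ * X <= _ -> _]eq_bigr do (cbn [reval]; rewrite reval_rpow).
Qed.

End Certificates.

(** * Comparison of two laws of the direction *)

Section Logarithms.
Context {R : realType}.
Implicit Types (x y r s : R).

Lemma ln_le_subr1 x : 0 < x -> ln x <= x - 1.
Proof.
by move=> x0; have := @le_ln1Dx R (x - 1); rewrite (addrC 1) subrK; apply; lra.
Qed.

Lemma ln_div x y : 0 < x -> 0 < y -> ln (x / y) = ln x - ln y.
Proof. by move=> x0 y0; rewrite lnM ?posrE ?invr_gt0 // lnV ?posrE. Qed.

Lemma ln_le_tangent x r : 0 < x -> 0 < r -> ln x <= ln r + (x / r - 1).
Proof.
move=> x0 r0; have := @ln_le_subr1 (x / r) (divr_gt0 x0 r0).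
by rewrite ln_div //; lra.
Qed.

(* [y |-> ln (expR y + s)] is convex; this is its tangent at [ln r]. *)
Lemma ln_addr_ge x r s : 0 < x -> 0 < r -> 0 <= s ->
  ln (r + s) + r / (r + s) * (ln x - ln r) <= ln (x + s).
Proof.
move=> x0 r0 s0.
have rs0 : 0 < r + s by lra.
have xs0 : 0 < x + s by lra.
have h1 : 0 < (x + s) / (r + s) by exact: divr_gt0.
have h2 : 0 < x / r by exact: divr_gt0.
(* Weighted arithmetic-geometric inequality: with weights [r / (r + s)] and [s / (r + s)], the mean
   of [x / r] and 1 is exactly [(x + s) / (r + s)], so the right-hand sides of the two bounds
   [ln z <= z - 1] cancel. *)
have H1 := ln_le_subr1 (divr_gt0 ltr01 h1).
have H2 := ln_le_subr1 (divr_gt0 h2 h1).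
rewrite (ln_div ltr01 h1) ln1 in H1; rewrite (ln_div h2 h1) (ln_div x0 r0) in H2.
rewrite (ln_div xs0 rs0) in H1 H2.
have p0 : 0 <= r / (r + s) by apply: divr_ge0; lra.
have q0 : 0 <= s / (r + s) by apply: divr_ge0; lra.
have pq : s / (r + s) = 1 - r / (r + s) by field; lra.
have := ler_wpM2l p0 H2; have := ler_wpM2l q0 H1.
have : r / (r + s) * (x / r / ((x + s) / (r + s)) - 1) +
   s / (r + s) * (1 / ((x + s) / (r + s)) - 1) = 0.
  by field; apply/and3P; split; lra.
rewrite pq => E A B.
set p := r / (r + s) in A B E *; lra.
Qed.

End Logarithms.

Section Sums.
Context {R : realType}.
Variable (T : seq R).
Implicit Types (u v : R -> R).

Lemma sumr_ge0_seq u : (forall t, t \in T -> 0 <= u t) -> 0 <= \sum_(t <- T) u t.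
Proof. by move=> h; rewrite big_seq; apply: sumr_ge0. Qed.

Lemma ler_sum_mem u v : (forall t, t \in T -> u t <= v t) ->
  \sum_(t <- T) u t <= \sum_(t <- T) v t.
Proof. by move=> h; rewrite big_seq [leRHS]big_seq; apply: ler_sum. Qed.

Lemma sumr_cst (c : R) : \sum_(t <- T) c = (size T)%:R * c.
Proof. by rewrite big_const_seq count_predT iter_addr_0 mulr_natl. Qed.

Lemma sum_affine (a b c : R) u : \sum_(t <- T) (a + b * (u t - c)) =
  (size T)%:R * a + b * (\sum_(t <- T) u t - (size T)%:R * c).
Proof.
rewrite big_split /= sumr_cst; congr (_ + _).
by rewrite -mulr_sumr sumrB sumr_cst.
Qed.

End Sums.

Lemma sum_CauchySchwarz {R : realType} (T : seq R) (u v : R -> R) :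
  (\sum_(t <- T) u t * v t) ^+ 2 <=
  (\sum_(t <- T) u t ^+ 2) * (\sum_(t <- T) v t ^+ 2).
Proof.
elim: T => [|t T IH]; first by rewrite !big_nil mulr0 expr0n.
rewrite !big_cons.
have : 0 <= \sum_(t <- T) u t ^+ 2 by apply: sumr_ge0 => i _; exact: sqr_ge0.
have : 0 <= \sum_(t <- T) v t ^+ 2 by apply: sumr_ge0 => i _; exact: sqr_ge0.
move: IH; set S := \sum_(t <- T) u t * v t; set a := u t; set b := v t.
set A := \sum_(t <- T) _; set B := \sum_(t <- T) _ => IH B0 A0.
have h : 2 * a * b * S <= a ^+ 2 * B + b ^+ 2 * A.
  apply: le_trans (ler_norm _) _; rewrite -ler_sqr ?nnegrE ?normr_ge0 //; last first.
    by apply: addr_ge0; apply: mulr_ge0; rewrite ?sqr_ge0.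
  rewrite real_normK ?num_real //.
  apply: (@le_trans _ _ (4 * (a * b) ^+ 2 * (A * B))).
    rewrite (_ : (2 * a * b * S) ^+ 2 = 4 * (a * b) ^+ 2 * S ^+ 2); last by ring.
    by apply: ler_wpM2l => //; apply: mulr_ge0; rewrite ?sqr_ge0.
  by have := sqr_ge0 (a ^+ 2 * B - b ^+ 2 * A); lra.
lra.
Qed.

Lemma ln_prod_seq {R : realType} (T : seq R) (f : R -> R) :
  (forall t, t \in T -> 0 < f t) ->
  ln (\prod_(t <- T) f t) = \sum_(t <- T) ln (f t).
Proof.
elim: T => [|t T IH] h; first by rewrite !big_nil ln1.
have h' t' : t' \in T -> 0 < f t' by move=> tT; apply: h; rewrite inE tT orbT.
rewrite !big_cons lnM ?posrE ?IH ?h ?mem_head //.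
by rewrite big_seq; apply: prodr_gt0.
Qed.

(** * From the extreme parameters to all parameters *)

Section LawComparison.
Context {R : realType}.
Variables (K0 : R) (L T : seq R).
Hypotheses (szL : size L = 16) (szT : size T = 4).
Hypotheses (L_itv : forall l, l \in L -> 0 <= l < K0).
Hypotheses (T_itv : forall t, t \in T -> 0 <= t < K0).
Hypothesis gap_ineq :
  ((\sum_(t <- T) (K0 - t) ^+ 2) / 4) ^+ 8 <= \prod_(l <- L) (K0 - l).
Hypothesis norm1_ineq :
  (2 + (\sum_(l <- L) l) / 16) ^+ 2 * (\sum_(t <- T) (1 / (2 + t)) ^+ 2) <= 4.
Hypothesis norm2_ineq :
  (4 + (\sum_(l <- L) l ^+ 2) / 16) *
  (\sum_(t <- T) (1 / (4 + t ^+ 2))) <= 4.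
Implicit Types (Phi : R -> R).

(** The left side is the logarithm in a summand of [Lbound]; the right side bounds the expected gain
    from below when [Phi] is decreasing. If [L] were four copies of [T], Jensen's inequality would
    give the opposite direction. *)
Definition mean_le Phi :=
  ln (4^-1 * \sum_(t <- T) Phi t) <= 16^-1 * \sum_(l <- L) ln (Phi l).

Lemma sumT_gt0 Phi : (forall t, t \in T -> 0 < Phi t) ->
  0 < 4^-1 * \sum_(t <- T) Phi t.
Proof.
move=> h; apply: mulr_gt0; first by rewrite invr_gt0.
case: T szT h => [//|t T'] _ h; rewrite big_cons.
apply: ltr_wpDr; last by apply: h; rewrite mem_head.
by apply: sumr_ge0_seq => u uT; rewrite ltW // h // inE uT orbT.
Qed.

Lemma mean_leZ Phi c : 0 < c -> (forall l, l \in L -> 0 < Phi l) ->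
  (forall t, t \in T -> 0 < Phi t) ->
  mean_le Phi -> mean_le (fun t => c * Phi t).
Proof.
move=> c0 hL hT; rewrite /mean_le => h.
rewrite -mulr_sumr mulrCA lnM ?posrE ?sumT_gt0 //.
under [X in _ <= _ * X]eq_big_seq => l lL do rewrite lnM ?posrE ?hL //.
by rewrite big_split /= sumr_cst szL; lra.
Qed.

(** Let [r] be the root mean square of [K0 - t]; then [gap_ineq] gives [16 ln r] as a lower bound
    for the sum of [ln (K0 - l)]. The tangent inequality [ln_addr_ge] is used twice, to add [K - K0]
    to the gaps and to add [tau] to their squares. In between, the root mean square of [K - t] is at
    most [r + (K - K0)], as in Minkowski's inequality. A nonzero [tau] is needed for the Euclidean
    norm. *)
Lemma sum_ln_gap K tau : K0 <= K -> 0 <= tau ->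
  16 * ln (4^-1 * (\sum_(t <- T) (K - t) ^+ 2) + tau) <=
  \sum_(l <- L) ln ((K - l) ^+ 2 + tau).
Proof.
move=> K0K tau0.
have TK t : t \in T -> 0 < K0 - t by move=> /T_itv/andP[_]; rewrite subr_gt0.
have LK l : l \in L -> 0 < K0 - l by move=> /L_itv/andP[_]; rewrite subr_gt0.
have A0 : 0 < 4^-1 * \sum_(t <- T) (K0 - t) ^+ 2.
  by apply: sumT_gt0 => t tT; rewrite exprn_gt0 ?TK.
have lnA : 8 * ln (4^-1 * \sum_(t <- T) (K0 - t) ^+ 2) <=
    \sum_(l <- L) ln (K0 - l).
  rewrite -ln_prod_seq // -[8]/(8%:R) mulr_natl -lnXn //.
  by rewrite ler_ln ?posrE ?exprn_gt0 ?(lt_le_trans _ gap_ineq) // mulrC // exprn_gt0.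
have B0 : 0 < 4^-1 * \sum_(t <- T) (K - t) ^+ 2.
  by apply: sumT_gt0 => t tT; rewrite exprn_gt0 //; have := TK t tT; lra.
set A := 4^-1 * _ in A0 lnA *.
set r := Num.sqrt A.
have r0 : 0 < r by rewrite sqrtr_gt0.
have r2 : r ^+ 2 = A by rewrite sqr_sqrtr // ltW.
have lnr : ln A = 2 * ln r by rewrite -r2 lnXn // mulr_natl.
set s := K - K0.
have s0 : 0 <= s by rewrite subr_ge0.
have rs0 : 0 < r + s by lra.
have step : 16 * ln (r + s) <= \sum_(l <- L) ln (K - l).
  apply: (@le_trans _ _ (\sum_(l <- L)
      (ln (r + s) + r / (r + s) * (ln (K0 - l) - ln r)))).
    rewrite sum_affine szL lerDl.
    by apply: mulr_ge0; [apply: divr_ge0; lra | lra].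
  apply: ler_sum_mem => l lL; rewrite (_ : K - l = (K0 - l) + s).
    by apply: ln_addr_ge => //; exact: LK.
  by rewrite /s; ring.
set B := 4^-1 * _ in B0 *.
have Brs : B <= (r + s) ^+ 2.
  have S1 : \sum_(t <- T) (K0 - t) <= 4 * r.
    have CS := @sum_CauchySchwarz R T (fun t => K0 - t) (fun=> 1).
    rewrite -ler_sqr ?nnegrE ?mulr_ge0 ?(ltW r0) //; last first.
      by apply: sumr_ge0_seq => t tT; rewrite ltW ?TK.
    move: CS; under eq_bigr do rewrite mulr1.
    by rewrite sumr_cst szT exprMn r2 /A; lra.
  rewrite /B (_ : \sum_(t <- T) _ = \sum_(t <- T) (K0 - t) ^+ 2
    + 2 * s * \sum_(t <- T) (K0 - t) + 4 * s ^+ 2).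
    have := ler_wpM2l s0 S1; move: r2; rewrite /A; lra.
  have <- : \sum_(t <- T) s ^+ 2 = 4 * s ^+ 2 by rewrite sumr_cst szT.
  rewrite mulr_sumr -!big_split /=.
  by apply: eq_bigr => t _; rewrite /s; ring.
have KL l : l \in L -> 0 < K - l by move=> /LK; lra.
have step2 : 16 * ln B <= \sum_(l <- L) ln ((K - l) ^+ 2).
  under eq_big_seq => l lL do rewrite lnXn ?KL // -mulr_natl.
  rewrite -mulr_sumr.
  have : ln B <= 2 * ln (r + s).
    by rewrite mulr_natl -lnXn // ler_ln ?posrE ?exprn_gt0.
  lra.
apply: (@le_trans _ _ (\sum_(l <- L)
    (ln (B + tau) + B / (B + tau) * (ln ((K - l) ^+ 2) - ln B)))).
  rewrite sum_affine szL lerDl.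
  by apply: mulr_ge0; [apply: divr_ge0; lra | lra].
by apply: ler_sum_mem => l lL; apply: ln_addr_ge => //; rewrite exprn_gt0 ?KL.
Qed.

(** Jensen's inequality at the mean [mu] of [L] reduces this to [c ^ 2 * V <= 1], which is
    [norm1_ineq] for [sigma = 1 / 2]. Passing to a smaller [sigma] amounts to adding
    [s = 1 / sigma - 2] to every [2 + t]. *)
Lemma sum_ln_norm1 sigma : 0 < sigma <= 2^-1 ->
  \sum_(l <- L) ln (1 + sigma * l) <=
  - (8 * ln (4^-1 * \sum_(t <- T) (1 / (1 + sigma * t)) ^+ 2)).
Proof.
move=> /andP[s0 s1].
set V := 4^-1 * _; set mu := (\sum_(l <- L) l) / 16.
have T0 t : t \in T -> 0 <= t by move=> /T_itv/andP[].
have L0 l : l \in L -> 0 <= l by move=> /L_itv/andP[].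
have mu0 : 0 <= mu by apply: divr_ge0 => //; exact: sumr_ge0_seq.
have V0 : 0 < V.
  apply: sumT_gt0 => t tT; rewrite exprn_gt0 // divr_gt0 //.
  by have := mulr_ge0 (ltW s0) (T0 t tT); lra.
set c := 1 + sigma * mu.
have c0 : 0 < c by have := mulr_ge0 (ltW s0) mu0; rewrite /c; lra.
have cV : c ^+ 2 * V <= 1.
  set s := sigma^-1 - 2.
  have s0' : 0 <= s.
    rewrite subr_ge0 -[2]invrK lef_pV2 ?posrE ?invr_gt0 //.
  set r := 2 + mu.
  have r0 : 0 < r by rewrite /r; lra.
  have rs0 : 0 < r + s by lra.
  have E1 : c = sigma * (r + s) by rewrite /c /r /s; field; lra.
  have E2 : V = (sigma ^+ 2)^-1 * (4^-1 * \sum_(t <- T) (1 / (2 + t + s)) ^+ 2).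
    rewrite /V mulrCA; congr (_ * _); rewrite mulr_sumr.
    apply: eq_big_seq => t tT; have := T0 t tT => t0.
    have ? : 0 < 1 + sigma * t by have := mulr_ge0 (ltW s0) t0; lra.
    have -> : 2 + t + s = sigma^-1 * (1 + sigma * t) by rewrite /s; field; lra.
    by field; apply/andP; split; lra.
  (* [(X + s)^-2] is a concave function of [X^-2]; this is its tangent at [X = r], of slope
     [(r / (r + s))^3]. Summed over [T], the linear term is nonpositive by [norm1_ineq]. *)
  have key t : t \in T -> (1 / (2 + t + s)) ^+ 2 <= 1 / (r + s) ^+ 2 +
      (r / (r + s)) ^+ 3 * ((1 / (2 + t)) ^+ 2 - 1 / r ^+ 2).
    move=> /T0 t0; set X := 2 + t.
    have X0 : 0 < X by rewrite /X; lra.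
    have Xs0 : 0 < X + s by lra.
    rewrite -subr_ge0 (_ : _ - _ = s * (X - r) ^+ 2 *
       (X * (X + 2 * r) + s * (2 * X + r)) /
       (X ^+ 2 * (X + s) ^+ 2 * (r + s) ^+ 3)); last first.
      by field; repeat (apply/andP; split); lra.
    apply: divr_ge0; last by rewrite ltW // !mulr_gt0 ?exprn_gt0.
    apply: mulr_ge0; first by rewrite mulr_ge0 ?sqr_ge0.
    by rewrite addr_ge0 // mulr_ge0 //; lra.
  have S : \sum_(t <- T) (1 / (2 + t + s)) ^+ 2 <= 4 * (1 / (r + s) ^+ 2).
    apply: (le_trans (ler_sum_mem key)).
    rewrite sum_affine szT gerDl.
    apply: mulr_ge0_le0; first by rewrite exprn_ge0 // divr_ge0 // ltW.
    move: norm1_ineq; rewrite -/mu -/r => h.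
    rewrite subr_le0 mul1r ler_pdivlMr ?exprn_gt0 // mulrC; lra.
  rewrite E1 E2 exprMn mulrACA divff ?mul1r; last by rewrite expf_neq0; lra.
  have := ler_wpM2l (sqr_ge0 (r + s)) S.
  rewrite [_ * (4 * _)](_ : _ = 4); first lra.
  by field; lra.
apply: (@le_trans _ _ (16 * ln c)).
  apply: (@le_trans _ _ (\sum_(l <- L) (ln c + ((1 + sigma * l) / c - 1)))).
    apply: ler_sum_mem => l lL; apply: ln_le_tangent => //.
    by have := mulr_ge0 (ltW s0) (L0 l lL); lra.
  rewrite big_split /= sumrB -mulr_suml big_split /= -mulr_sumr !sumr_cst szL.
  have -> : \sum_(l <- L) l = 16 * mu by rewrite /mu; field.
  rewrite (_ : _ / c = 16); last by rewrite /c; field; rewrite -/c; lra.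
  lra.
have : ln (c ^+ 2 * V) <= 0 by apply: ln_le0.
by rewrite lnM ?posrE ?exprn_gt0 // lnXn // -mulr_natl; lra.
Qed.

Lemma sum_ln_norm2 sigma : 0 < sigma <= 2^-1 ->
  \sum_(l <- L) ln (1 + sigma ^+ 2 * l ^+ 2) <=
  - (16 * ln (4^-1 * \sum_(t <- T) (1 / (1 + sigma ^+ 2 * t ^+ 2)))).
Proof.
move=> /andP[s0 s1]; set q := sigma ^+ 2.
have q0 : 0 < q by rewrite exprn_gt0.
have q1 : q <= 4^-1.
  have : q <= 2^-1 ^+ 2 by rewrite lerXn2r ?nnegrE ?(ltW s0) ?invr_ge0.
  by rewrite exprVn; lra.
set V := 4^-1 * _; set mu := (\sum_(l <- L) l ^+ 2) / 16.
have mu0 : 0 <= mu.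
  by apply: divr_ge0 => //; apply: sumr_ge0_seq => l _; exact: sqr_ge0.
have p1 t : 0 < 1 + q * t ^+ 2.
  by have := mulr_ge0 (ltW q0) (sqr_ge0 t); lra.
have V0 : 0 < V by apply: sumT_gt0 => t _; rewrite divr_gt0.
set c := 1 + q * mu.
have c0 : 0 < c by have := mulr_ge0 (ltW q0) mu0; rewrite /c; lra.
have cV : c * V <= 1.
  set s := q^-1 - 4.
  have s0' : 0 <= s.
    by rewrite subr_ge0 -[4]invrK lef_pV2 ?posrE ?invr_gt0.
  set r := 4 + mu.
  have r0 : 0 < r by rewrite /r; lra.
  have rs0 : 0 < r + s by lra.
  have E1 : c = q * (r + s) by rewrite /c /r /s; field; lra.
  have E2 : V = q^-1 * (4^-1 * \sum_(t <- T) (1 / (4 + t ^+ 2 + s))).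
    rewrite /V mulrCA; congr (_ * _); rewrite mulr_sumr.
    apply: eq_big_seq => t tT; have := p1 t => ?.
    have -> : 4 + t ^+ 2 + s = q^-1 * (1 + q * t ^+ 2) by rewrite /s; field; lra.
    by field; apply/andP; split; lra.
  (* The same tangent argument for [1 / (X + s)] as a concave function of [1 / X], with slope
     [(r / (r + s))^2] at [X = r]. *)
  have key t : t \in T -> 1 / (4 + t ^+ 2 + s) <= 1 / (r + s) +
      (r / (r + s)) ^+ 2 * (1 / (4 + t ^+ 2) - 1 / r).
    move=> _; set X := 4 + t ^+ 2.
    have X0 : 0 < X by have := sqr_ge0 t; rewrite /X; lra.
    have Xs0 : 0 < X + s by lra.
    rewrite -subr_ge0 (_ : _ - _ = s * (X - r) ^+ 2 /
       (X * (X + s) * (r + s) ^+ 2)); last first.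
      by field; repeat (apply/andP; split); lra.
    apply: divr_ge0; first by rewrite mulr_ge0 ?sqr_ge0.
    by rewrite ltW // !mulr_gt0 ?exprn_gt0.
  have S : \sum_(t <- T) (1 / (4 + t ^+ 2 + s)) <= 4 * (1 / (r + s)).
    apply: (le_trans (ler_sum_mem key)).
    rewrite sum_affine szT gerDl.
    apply: mulr_ge0_le0; first by rewrite exprn_ge0 // divr_ge0 // ltW.
    move: norm2_ineq; rewrite -/mu -/r => h.
    rewrite subr_le0 mul1r ler_pdivlMr // mulrC; lra.
  rewrite E1 E2 mulrACA divff ?mul1r; last by lra.
  have := ler_wpM2l (ltW rs0) S.
  rewrite [_ * (4 * _)](_ : _ = 4); first lra.
  by field; lra.
apply: (@le_trans _ _ (16 * ln c)).
  apply: (@le_trans _ _ (\sum_(l <- L) (ln c + ((1 + q * l ^+ 2) / c - 1)))).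
    by apply: ler_sum_mem => l lL; apply: ln_le_tangent.
  rewrite big_split /= sumrB -mulr_suml big_split /= -mulr_sumr !sumr_cst szL.
  have -> : \sum_(l <- L) l ^+ 2 = 16 * mu by rewrite /mu; field.
  rewrite (_ : _ / c = 16); last by rewrite /c; field; rewrite -/c; lra.
  lra.
have : ln (c * V) <= 0 by apply: ln_le0.
by rewrite lnM ?posrE //; lra.
Qed.

Lemma mean_le_gap K : K0 <= K -> mean_le (fun t => K - t).
Proof.
move=> K0K; have TK t : t \in T -> 0 < K - t.
  by move=> /T_itv/andP[_]; lra.
have LK l : l \in L -> 0 < K - l by move=> /L_itv/andP[_]; lra.
have := sum_ln_gap K0K (lexx 0); rewrite addr0.
under [X in _ <= X -> _]eq_big_seq => l lL
  do rewrite addr0 lnXn ?LK // -mulr_natl.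
rewrite -mulr_sumr /mean_le.
have M0 := sumT_gt0 TK.
set M := 4^-1 * _ in M0 *; set Q := 4^-1 * _.
have MQ : M ^+ 2 <= Q.
  have := @sum_CauchySchwarz R T (fun t => K - t) (fun=> 1).
  under eq_bigr do rewrite mulr1.
  by rewrite sumr_cst szT /M /Q exprMn; lra.
have : ln (M ^+ 2) <= ln Q.
  by rewrite ler_ln ?posrE ?(lt_le_trans _ MQ) ?exprn_gt0.
by rewrite lnXn // -mulr_natl; lra.
Qed.

(** By Cauchy-Schwarz the squared mean over [T] is at most [Q * V], the product of the mean squares
    of [K - t] and of [1 / (1 + sigma t)]. Numerator and denominator are thus compared with [L]
    separately, which is why [sum_ln_gap] and [sum_ln_norm1] are about squares. *)
Lemma mean_le_norm1 K sigma : K0 <= K -> 0 < sigma <= 2^-1 ->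
  mean_le (fun t => (K - t) / (1 + sigma * t)).
Proof.
move=> K0K s01; have /andP[s0 _] := s01.
have TK t : t \in T -> 0 < K - t by move=> /T_itv/andP[_]; lra.
have LK l : l \in L -> 0 < K - l by move=> /L_itv/andP[_]; lra.
have Ts t : t \in T -> 0 < 1 + sigma * t.
  by move=> /T_itv/andP[t0 _]; have := mulr_ge0 (ltW s0) t0; lra.
have Ls l : l \in L -> 0 < 1 + sigma * l.
  by move=> /L_itv/andP[t0 _]; have := mulr_ge0 (ltW s0) t0; lra.
have := sum_ln_gap K0K (lexx 0); rewrite addr0.
under [X in _ <= X -> _]eq_big_seq => l lL
  do rewrite addr0 lnXn ?LK // -mulr_natl.
rewrite -mulr_sumr /mean_le => H1; have H2 := sum_ln_norm1 s01.
under [X in _ <= _ * X]eq_big_seq => l lL do rewrite ln_div ?LK ?Ls //.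
rewrite sumrB.
have M0 : 0 < 4^-1 * \sum_(t <- T) (K - t) / (1 + sigma * t).
  by apply: sumT_gt0 => t tT; rewrite divr_gt0 ?TK ?Ts.
have Q0 : 0 < 4^-1 * \sum_(t <- T) (K - t) ^+ 2.
  by apply: sumT_gt0 => t tT; rewrite exprn_gt0 ?TK.
have V0 : 0 < 4^-1 * \sum_(t <- T) (1 / (1 + sigma * t)) ^+ 2.
  by apply: sumT_gt0 => t tT; rewrite exprn_gt0 // divr_gt0 ?Ts.
have := @sum_CauchySchwarz R T (fun t => K - t) (fun t => 1 / (1 + sigma * t)).
under eq_bigr do rewrite mul1r.
move: H1 H2 M0 Q0 V0; set Q := 4^-1 * _; set V := 4^-1 * _; set M := 4^-1 * _.
move=> H1 H2 M0 Q0 V0 CS.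
have MQ : M ^+ 2 <= Q * V by rewrite /M /Q /V exprMn; lra.
clearbody M Q V; have : ln (M ^+ 2) <= ln (Q * V).
  by rewrite ler_ln ?posrE ?(lt_le_trans _ MQ) ?exprn_gt0.
by rewrite lnXn // lnM ?posrE // -mulr_natl; lra.
Qed.

Lemma mean_le_norm2 K tau sigma : K0 <= K -> 0 <= tau -> 0 < sigma <= 2^-1 ->
  mean_le (fun t => Num.sqrt (((K - t) ^+ 2 + tau) / (1 + sigma ^+ 2 * t ^+ 2))).
Proof.
move=> K0K tau0 s01; have /andP[s0 _] := s01.
have TK t : t \in T -> 0 < (K - t) ^+ 2 + tau.
  by move=> /T_itv/andP[_ ?]; rewrite ltr_wpDr // exprn_gt0; lra.
have LK l : l \in L -> 0 < (K - l) ^+ 2 + tau.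
  by move=> /L_itv/andP[_ ?]; rewrite ltr_wpDr // exprn_gt0; lra.
have Ts t : 0 < 1 + sigma ^+ 2 * t ^+ 2.
  by have := mulr_ge0 (sqr_ge0 sigma) (sqr_ge0 t); lra.
have H1 := sum_ln_gap K0K tau0; have H2 := sum_ln_norm2 s01.
have lnsqrt (y : R) : 0 < y -> ln (Num.sqrt y) = 2^-1 * ln y.
  move=> y0; rewrite -{2}[y]sqr_sqrtr ?(ltW y0) // lnXn ?sqrtr_gt0 //.
  by rewrite -mulr_natl; lra.
rewrite /mean_le.
under [X in _ <= _ * X]eq_big_seq => l lL
  do rewrite lnsqrt ?divr_gt0 ?LK // ln_div ?LK //.
rewrite -mulr_sumr sumrB.
have M0 : 0 < 4^-1 * \sum_(t <- T)
    Num.sqrt (((K - t) ^+ 2 + tau) / (1 + sigma ^+ 2 * t ^+ 2)).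
  by apply: sumT_gt0 => t tT; rewrite sqrtr_gt0 divr_gt0 ?TK.
have Q0 : 0 < 4^-1 * (\sum_(t <- T) (K - t) ^+ 2) + tau.
  rewrite ltr_wpDr //; apply: sumT_gt0 => t /T_itv/andP[_ ?].
  by rewrite exprn_gt0; lra.
have V0 : 0 < 4^-1 * \sum_(t <- T) (1 / (1 + sigma ^+ 2 * t ^+ 2)).
  by apply: sumT_gt0 => t tT; rewrite divr_gt0.
have := @sum_CauchySchwarz R T (fun t => Num.sqrt ((K - t) ^+ 2 + tau))
  (fun t => Num.sqrt (1 / (1 + sigma ^+ 2 * t ^+ 2))).
under eq_big_seq => t tT do rewrite -sqrtrM ?(ltW (TK t tT)) // mul1r.
under [X in _ <= X * _ -> _]eq_big_seq => t tT do rewrite sqr_sqrtr ?(ltW (TK t tT)) //.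
under [X in _ <= _ * X -> _]eq_bigr => t _ do rewrite sqr_sqrtr ?divr_ge0 ?(ltW (Ts t)) //.
rewrite big_split /= sumr_cst szT.
move: H1 H2 M0 Q0 V0; set Q := 4^-1 * _ + _; set V := 4^-1 * _; set M := 4^-1 * _.
move=> H1 H2 M0 Q0 V0 CS.
have MQ : M ^+ 2 <= Q * V.
  by rewrite /M /Q /V exprMn; lra.
clearbody M Q V; have : ln (M ^+ 2) <= ln (Q * V).
  by rewrite ler_ln ?posrE ?(lt_le_trans _ MQ) ?exprn_gt0.
by rewrite lnXn // lnM ?posrE // -mulr_natl; lra.
Qed.

End LawComparison.

(** * Dynamics of the direction *)

Section Average.
Context {R : realType}.
Implicit Types (f g : seq bool -> R).

Fixpoint avg (n : nat) (f : seq bool -> R) : R :=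
  if n is n'.+1 then
    2^-1 * (avg n' (fun w => f (true :: w)) + avg n' (fun w => f (false :: w)))
  else f [::].

Lemma ler_avg n f g : (forall w, size w = n -> f w <= g w) -> avg n f <= avg n g.
Proof.
elim: n f g => [|n IH] f g h /=; first exact: h.
by apply: ler_wpM2l => //; apply: lerD; apply: IH => w wn; apply: h; rewrite /= wn.
Qed.

Lemma eq_avg n f g : f =1 g -> avg n f = avg n g.
Proof.
by move=> h; apply/eqP; rewrite eq_le !ler_avg // => w _; rewrite h.
Qed.

Lemma avg_cst n (c : R) : avg n (fun=> c) = c.
Proof. by elim: n => [//|n IH] /=; rewrite !IH; lra. Qed.

Lemma avgD n f g : avg n (fun w => f w + g w) = avg n f + avg n g.
Proof. by elim: n f g => [//|n IH] f g /=; rewrite !IH; lra. Qed.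

Lemma avgN n f : avg n (fun w => - f w) = - avg n f.
Proof. by elim: n f => [//|n IH] f /=; rewrite !IH; lra. Qed.

Lemma avgB n f g : avg n (fun w => f w - g w) = avg n f - avg n g.
Proof. by rewrite avgD avgN. Qed.

Lemma avg_cat m n f :
  avg (m + n) f = avg m (fun u => avg n (fun v => f (u ++ v))).
Proof. by elim: m f => [//|m IH] f /=; rewrite !IH. Qed.

End Average.

Lemma ke_gt {R : realType} (k e : R) : 1 < e -> e < 2 -> e * (k - e) = k ->
  4 < k /\ 2 < k - e.
Proof.
move=> e1 e2 ke.
have E : (e - 1) * (k - 4) = (2 - e) ^+ 2 by move: ke; lra.
have k4 : 4 < k.
  have : 0 < (2 - e) ^+ 2 by rewrite exprn_gt0 // subr_gt0.
  by rewrite -E pmulr_rgt0 ?subr_gt0.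
by split => //; lra.
Qed.

Section Dynamics.
Context {R : realType}.
Variables (k e : R).
Hypotheses (e_gt1 : 1 < e) (e_lt2 : e < 2) (ke : e * (k - e) = k).
Implicit Types (w : seq bool) (o eta : R).

Let k_gt4 : 4 < k. Proof. by have [] := ke_gt e_gt1 e_lt2 ke. Qed.

Let ke2 : 2 < k - e. Proof. by have [] := ke_gt e_gt1 e_lt2 ke. Qed.

Let e1ke : (e - 1) * (k - e) = e. Proof. by move: ke; lra. Qed.

(* [omega o w = s x / y] for the image [(x, y)] of the vector [(o / s, 1)] under
   the product of shears spelled by [w], where [s = - alpha] and [true] stands
   for [A]; [logy o w = ln |y|]. *)
Fixpoint omega o w : R :=
  match w with
  | [::] => o
  | true :: w' => omega o w' / (1 - omega o w')
  | false :: w' => omega o w' + k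
  end.

Fixpoint logy o w : R :=
  match w with
  | [::] => 0
  | true :: w' => logy o w' + ln `|1 - omega o w'|
  | false :: w' => logy o w'
  end.

(** Applying B and then A fixes [- e]: first [- e + k = k - e], then
    [(k - e) / (1 - (k - e)) = - e]. Hence both shears preserve the cone bounded by these two
    directions, and the sign of [omega] shows whether A was applied last. *)
Lemma omega_cone o w : k - e <= o ->
  if w is true :: _ then - e <= omega o w < 0 else k - e <= omega o w.
Proof.
have k4 := k_gt4; have k2 := ke2; have e1 := e_gt1; have e2 := e_lt2.
move=> ho; elim: w => [//|[] w IH] /=; last by case: w IH => [|[] w] /=; lra.
have [h|h] : - e <= omega o w < 0 \/ k - e <= omega o w.
    by case: w IH => [|[] w]; [right|left|right].
- have /andP[h1 h2] := h; have d : 0 < 1 - omega o w by lra.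
  rewrite ltr_pdivrMr // mul0r h2 andbT ler_pdivlMr //.
  have : 0 <= (- omega o w) * e by apply: mulr_ge0; lra.
  lra.
- have d : 0 < omega o w - 1 by lra.
  rewrite (_ : _ / _ = - (omega o w / (omega o w - 1))); last by field; lra.
  rewrite oppr_lt0 divr_gt0 ?andbT //; last by lra.
  rewrite lerN2 ler_pdivrMr //.
  have : 0 <= (e - 1) * (omega o w - (k - e)) by apply: mulr_ge0; lra.
  by move: e1ke; lra.
Qed.

Lemma omega_neq0 o w : k - e <= o -> omega o w != 0.
Proof.  have k4 := k_gt4; have k2 := ke2; have e1 := e_gt1; have e2 := e_lt2. by move=> /(omega_cone w); case: w => [|[] w] h; apply/eqP; lra. Qed.

Lemma omega_neq1 o w : k - e <= o -> 1 - omega o w != 0.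
Proof.  have k4 := k_gt4; have k2 := ke2; have e1 := e_gt1; have e2 := e_lt2. by move=> /(omega_cone w); case: w => [|[] w] h; apply/eqP; lra. Qed.

Lemma omega_le o w : k - e <= o -> o <= k -> omega o w <= (size w).+1%:R * k.
Proof.
have k4 := k_gt4; have k2 := ke2; have e1 := e_gt1; have e2 := e_lt2.
move=> ho ok; elim: w => [|[] w IH]; first by rewrite mul1r.
- have /andP[_ h] := omega_cone (true :: w) ho.
  by apply: (le_trans (ltW h)); apply: mulr_ge0 => //; lra.
- by move: IH; rewrite /= -[(size w).+2%:R]natr1 mulrDl mul1r lerD2r.
Qed.

Lemma omega_nseqB o w b : omega o (nseq b false ++ w) = omega o w + b%:R * k.
Proof.
elim: b => [|b IH] /=; first by rewrite mul0r addr0.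
by rewrite IH -natr1 mulrDl mul1r addrA.
Qed.

Lemma logy_nseqB o w b : logy o (nseq b false ++ w) = logy o w.
Proof. by elim: b. Qed.

Lemma omega_nseqA o w a : 1 < omega o w ->
  omega o (nseq a true ++ w) = omega o w / (1 - a%:R * omega o w).
Proof.
move=> h; elim: a => [|a IH] /=; first by rewrite mul0r subr0 divr1.
rewrite IH -natr1; set u := omega o w in h *; set n : R := a%:R.
have n0 : 0 <= n by rewrite ler0n.
have d1 : n * u != 1.
  have : a = 0%N \/ (0 < a)%N by case: (a) => [|?]; [left|right].
  rewrite /n; case=> [->|]; first by rewrite mul0r eq_sym oner_eq0.
  rewrite -(ler1n R) => a1; rewrite gt_eqF //.
  by apply: (lt_le_trans h); rewrite ler_peMl //; lra.
have d2 : 1 - (n + 1) * u < 0.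
  have := mulr_ge0 n0 (ltW (lt_trans ltr01 h)); lra.
have d3 : 1 - n * u != 0 by rewrite subr_eq0 eq_sym.
by field; rewrite d3 andbT /=; apply/eqP; lra.
Qed.

Lemma logy_nseqA o w a : 1 < omega o w ->
  logy o (nseq a true ++ w) = logy o w + ln `|1 - a%:R * omega o w|.
Proof.
move=> h; elim: a => [|a IH] /=; first by rewrite mul0r subr0 normr1 ln1 addr0.
rewrite IH omega_nseqA // -natr1; set u := omega o w in h *; set n : R := a%:R.
have n0 : 0 <= n by rewrite ler0n.
have d3 : 1 - n * u != 0.
  have : a = 0%N \/ (0 < a)%N by case: (a) => [|?]; [left|right].
  rewrite /n; case=> [->|]; first by rewrite mul0r subr0 oner_eq0.
  rewrite -(ler1n R) => a1; rewrite lt_eqF // subr_lt0.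
  by apply: (lt_le_trans h); rewrite ler_peMl //; lra.
have d2 : 1 - (n + 1) * u < 0.
  have := mulr_ge0 n0 (ltW (lt_trans ltr01 h)); lra.
(* The factors of [y] along a run of A telescope. *)
have -> : 1 - u / (1 - n * u) = (1 - (n + 1) * u) / (1 - n * u) by field.
rewrite normrM normfV ln_div ?normr_gt0 //; last by rewrite lt_eqF.
by lra.
Qed.

End Dynamics.

(** * The action of a block on directions *)

Section BlockMap.
Context {R : realType}.
Variables (k e : R).
Hypotheses (e_gt1 : 1 < e) (e_lt2 : e < 2) (ke : e * (k - e) = k).
Implicit Types (a b : nat) (eta : R).

Lemma width_gt b eta : (0 < b)%N -> eta <= e -> 2 < b%:R * k - eta.
Proof.
have [k4 k2] := ke_gt e_gt1 e_lt2 ke; rewrite -(ler1n R) => b1 he.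
have : 0 <= (b%:R - 1) * k by apply: mulr_ge0; lra.
lra.
Qed.

Lemma denom_gt a b eta : (0 < a)%N -> (0 < b)%N -> eta <= e ->
  1 < a%:R * (b%:R * k - eta) - 1.
Proof.
move=> a0 b0 he; have w2 := width_gt b0 he; move: a0; rewrite -(ler1n R) => a1.
have : 0 <= (a%:R - 1) * (b%:R * k - eta) by apply: mulr_ge0; lra.
lra.
Qed.

Lemma blockmap_gt0 a b eta : (0 < a)%N -> (0 < b)%N -> eta <= e ->
  0 < blockmap k a b eta.
Proof.
move=> a0 b0 he; have := width_gt b0 he; have := denom_gt a0 b0 he => d w2.
by apply: divr_gt0; lra.
Qed.

(** In terms of [w = b k - eta] the map is [w / (a w - 1)], which decreases in [w] as long as
    [a w > 1]. *)
Lemma blockmap_mono a b eta eta' : (0 < a)%N -> (0 < b)%N ->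
  eta <= eta' -> eta' <= e -> blockmap k a b eta <= blockmap k a b eta'.
Proof.
move=> a0 b0 le1 le2.
have w1 := width_gt b0 (le_trans le1 le2); have w2 := width_gt b0 le2.
have d1 := denom_gt a0 b0 (le_trans le1 le2); have d2 := denom_gt a0 b0 le2.
rewrite /blockmap ler_pdivrMr; last by lra.
by rewrite mulrAC ler_pdivlMr; lra.
Qed.

Lemma blockmap_anti_a a a' b eta : (0 < a)%N -> (a <= a')%N -> (0 < b)%N ->
  eta <= e -> blockmap k a' b eta <= blockmap k a b eta.
Proof.
move=> a0 aa' b0 he; have a'0 := leq_trans a0 aa'.
have w := width_gt b0 he; have d1 := denom_gt a0 b0 he.
have d2 := denom_gt a'0 b0 he.
move: aa'; rewrite -(ler_nat R) => aa'.
rewrite /blockmap ler_pM2l ?lef_pV2 ?posrE; [|lra|lra|lra].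
by rewrite lerD2r ler_wpM2r //; lra.
Qed.

Lemma blockmap_fix : blockmap k 1 1 e = e.
Proof.
have [k4 k2] := ke_gt e_gt1 e_lt2 ke; rewrite /blockmap !mul1r.
apply: (canLR (mulfK _)); first by apply/eqP; lra.
by move: ke; lra.
Qed.

Lemma blockmap_le_e a b eta : (0 < a)%N -> (0 < b)%N -> eta <= e ->
  blockmap k a b eta <= e.
Proof.
move=> a0 b0 he; apply: (le_trans (blockmap_anti_a _ a0 _ _)) => //.
apply: (le_trans (blockmap_mono _ _ he _)) => //.
have [k4 k2] := ke_gt e_gt1 e_lt2 ke; rewrite -[leRHS]blockmap_fix /blockmap !mul1r.
have w := width_gt b0 (lexx e).
move: (b0); rewrite -(ler1n R) => b1.
have : 0 <= (b%:R - 1) * k by apply: mulr_ge0; lra.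
move=> h; rewrite ler_pdivrMr; last by lra.
by rewrite mulrAC ler_pdivlMr; lra.
Qed.

Lemma blockmapS a b eta : (0 < a)%N -> (0 < b)%N -> eta <= e ->
  blockmap k a b eta / (1 + blockmap k a b eta) = blockmap k a.+1 b eta.
Proof.
move=> a0 b0 he; have w := width_gt b0 he; have d1 := denom_gt a0 b0 he.
have d2 := @denom_gt a.+1 b eta isT b0 he.
rewrite /blockmap -natr1 in d2 *.
move: w d1 d2; set u := b%:R * k - eta; set n : R := a%:R => w d1 d2.
by field; repeat (apply/andP; split); apply/eqP; lra.
Qed.

End BlockMap.

(** * The score of a word and its growth per block *)

Section BlockGain.
Context {R : realType}.
Variables (k e : R).
Hypotheses (e_gt1 : 1 < e) (e_lt2 : e < 2) (ke : e * (k - e) = k).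
Variable N : R -> R.
Implicit Types (a b m n : nat) (eta : R) (w : seq bool).

Local Notation omega := (omega k (k - 1)).
Local Notation logy := (logy k (k - 1)).

(** Prefixing an A makes the direction negative for every [w], so that no condition on the first
    letter is needed. *)
Definition eta_of w : R := - omega (true :: w).

(** This is [ln (Phi a b eta)]: the first term is the growth of [ln |y|], and [N] converts it into
    the growth of the chosen norm. *)
Definition block_gain a b eta : R :=
  ln (a%:R * (b%:R * k - eta) - 1) + N (blockmap k a b eta) - N eta.

Hypothesis N_ge0 : forall eta, 0 <= eta <= e -> 0 <= N eta.
Hypothesis gain_ge0 : forall a b eta, (0 < a)%N -> (0 < b)%N ->
  0 <= eta <= e -> 0 <= block_gain a b eta.

Lemma cone_start : k - e <= k - 1.
Proof. by have := e_gt1; lra. Qed.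

Lemma eta_ofP w : 0 < eta_of w <= e.
Proof.
have /andP[h1 h2] := omega_cone e_gt1 e_lt2 ke (true :: w) cone_start.
by rewrite oppr_gt0 h2 /= lerNl.
Qed.

Lemma omega_B b w : (0 < b)%N -> 1 < omega (nseq b false ++ w).
Proof.
case: b => // b _; have [k4 k2] := ke_gt e_gt1 e_lt2 ke.
by have /= := omega_cone e_gt1 e_lt2 ke (false :: nseq b false ++ w) cone_start; lra.
Qed.

Lemma eta_of_A w : eta_of (true :: w) = eta_of w / (1 + eta_of w).
Proof. by rewrite /eta_of /= mulNr. Qed.

Lemma eta_of_B w : eta_of (false :: w) = (omega w + k) / (omega w + k - 1).
Proof. by rewrite /eta_of /= -mulrN -invrN opprB. Qed.

(** [eta_of] itself supplies one of the [a] letters A, hence [a.-1]. The A in front of [w] gives the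
    vector before the block the coordinate [- eta_of w]. *)
Lemma eta_of_block a b w : (0 < a)%N -> (0 < b)%N ->
  eta_of (nseq a.-1 true ++ nseq b false ++ true :: w) =
  blockmap k a b (eta_of w).
Proof.
case: a => // a _ b0.
have he : eta_of w <= e by have /andP[] := eta_ofP w.
have d := denom_gt e_gt1 e_lt2 ke (ltn0Sn a) b0 he.
rewrite /eta_of -[true :: nseq a.+1.-1 _ ++ _]/(nseq a.+1 true ++ _).
rewrite (omega_nseqA _ (omega_B _ b0)) omega_nseqB /blockmap -/(eta_of w).
rewrite -[omega (true :: w)]opprK -/(eta_of w) -mulrN -invrN opprB.
by congr (_ / (_ * _ - 1)); rewrite addrC.
Qed.

(* [N eta] is the logarithm of the norm of [(- eta / s, 1)]; [nu] and hence [score]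
   ignore the leading run of [B], so that they only change when a run of [A] is
   read. *)
Fixpoint nu w : R :=
  match w with
  | [::] => 0
  | true :: w' => N (eta_of w')
  | false :: w' => nu w'
  end.

Definition score w : R := logy w + nu w.

(* The score at the start of the block that is being read. *)
Fixpoint block_score w : R :=
  match w with
  | [::] => 0
  | true :: w' => block_score w'
  | false :: w' => score w'
  end.

Lemma nu_ge0 w : 0 <= nu w.
Proof.
elim: w => [//|[] w IH] //=; apply: N_ge0.
by have /andP[/ltW -> ->] := eta_ofP w.
Qed.

Lemma score_B b w : score (nseq b false ++ w) = score w.
Proof. by elim: b. Qed.

Lemma score_block a b w : (0 < a)%N -> (0 < b)%N ->
  score (nseq a true ++ nseq b false ++ true :: w) - score (true :: w) =
  block_gain a b (eta_of w).
Proof.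
move=> a0 b0; have he : eta_of w <= e by have /andP[] := eta_ofP w.
have d := denom_gt e_gt1 e_lt2 ke a0 b0 he.
have Hnu : nu (nseq a true ++ nseq b false ++ true :: w) =
    N (blockmap k a b (eta_of w)).
  by rewrite -eta_of_block //; case: (a) a0.
rewrite /score Hnu (logy_nseqA _ (omega_B _ b0)) logy_nseqB omega_nseqB.
rewrite -[omega (true :: w)]opprK -/(eta_of w) distrC ger0_norm; last first.
  by rewrite addrC; lra.
by rewrite /block_gain (addrC (- _)) /=; lra.
Qed.

Lemma ln_run_ge0 a w : 1 < omega w - 1 -> 0 <= ln `|1 - a%:R * omega w|.
Proof.
move=> h; case: a => [|a]; first by rewrite mul0r subr0 normr1 ln1.
rewrite distrC ln_ge0 // ler_normr; apply/orP; left.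
have : 0 <= a%:R * omega w by apply: mulr_ge0; rewrite ?ler0n //; lra.
by rewrite -natr1; lra.
Qed.

Lemma omega_nil : 1 < omega [::] - 1.
Proof. by have [k4 k2] := ke_gt e_gt1 e_lt2 ke; rewrite /=; lra. Qed.

(** Only a sign is claimed, so [w] need not begin with A: a leading B joins the run of B, and at the
    empty word [omega] is so large that a run of A cannot decrease [|y|]. *)
Lemma score_AB_ge a b w : (0 < a)%N -> (0 < b)%N ->
  score w <= score (nseq a true ++ nseq b false ++ w).
Proof.
move=> a0; elim: w b => [|[] w IH] b b0.
- have h := omega_nil; have [k4 k2] := ke_gt e_gt1 e_lt2 ke.
  rewrite /score (logy_nseqA _ (omega_B _ b0)) logy_nseqB -addrA lerD2l.
  apply: addr_ge0; last exact: nu_ge0.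
  apply: ln_run_ge0; rewrite omega_nseqB.
  by apply: (lt_le_trans h); have := mulr_ge0 (ler0n R b) (ltW (lt_trans ltr01 (lt_trans _ k4))); lra.
- rewrite -subr_ge0 score_block //; apply: gain_ge0 => //.
  by have /andP[/ltW -> ->] := eta_ofP w.
- rewrite -[score (false :: w)]/(score w).
  suff -> : nseq b false ++ false :: w = nseq b.+1 false ++ w by exact: IH.
  by elim: (b) => //= b' ->.
Qed.

Lemma block_score_le a w : block_score w <= score (nseq a true ++ w).
Proof.
elim: w a => [|[] w IH] a.
- rewrite /score cats0 -[nseq a true]cats0 logy_nseqA; last first.
    by have := omega_nil; rewrite /=; lra.
  by rewrite -addrA add0r addr_ge0 ?nu_ge0 // ln_run_ge0 // omega_nil.
- suff -> : nseq a true ++ true :: w = nseq a.+1 true ++ w by exact: IH.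
  by elim: (a) => //= a' ->.
- by case: a => [//|a]; apply: (@score_AB_ge a.+1 1).
Qed.

(** With [m] letters unread, [gain] knows that the leftmost block has [a] letters A and at least [b]
    letters B, while [delta] knows only that it has at least [a] letters A. The next letter either
    extends the current run or ends it, which is the content of [gainS] and [deltaS]. *)
Definition gain m a b :=
  avg m (fun w => score (nseq a true ++ nseq b false ++ w) - score w).
Definition delta m a :=
  avg m (fun w => score (nseq a true ++ w) - block_score w).

Lemma gainS m a b : (0 < a)%N -> (0 < b)%N -> gain m.+1 a b =
  2^-1 * (avg m (fun w => block_gain a b (eta_of w)) + gain m a b.+1).
Proof.
move=> a0 b0; rewrite /gain /=; congr (_ * (_ + _)); apply: eq_avg => w.
  exact: score_block.
rewrite -[score (false :: w)]/(score w); congr (score (_ ++ _) - _).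
by elim: (b) => //= b' ->.
Qed.

Lemma deltaS m a : delta m.+1 a = 2^-1 * (delta m a.+1 + gain m a 1).
Proof.
rewrite /delta /=; congr (_ * (_ + _)); apply: eq_avg => w.
by congr (score _ - _); elim: (a) => //= a' ->.
Qed.

Lemma gain0 m b : gain m 0 b = 0.
Proof.
rewrite /gain (@eq_avg _ _ _ (fun=> 0)) ?avg_cst // => w.
by rewrite /= score_B subrr.
Qed.

Lemma gain_avg_ge0 m a b : (0 < b)%N -> 0 <= gain m a b.
Proof.
case: a => [|a] b0; first by rewrite gain0.
rewrite -[leLHS](avg_cst m); apply: ler_avg => w _.
by rewrite subr_ge0 score_AB_ge.
Qed.

Lemma delta_ge0 m a : 0 <= delta m a.
Proof.
rewrite -[leLHS](avg_cst m); apply: ler_avg => w _.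
by rewrite subr_ge0 block_score_le.
Qed.

(** A leading A leaves [block_score] unchanged and a leading B replaces it by [score]. This is one
    of the two factors 1/2 behind [4 lambda]; the other is in [deltaS] at [a = 0], where
    [gain m 0 1] vanishes. *)
Lemma avg_block_scoreS m :
  avg m.+1 block_score = avg m block_score + 2^-1 * delta m 0.
Proof.
have -> : delta m 0 = avg m score - avg m block_score by rewrite -avgB.
have -> : avg m.+1 block_score = 2^-1 * (avg m block_score + avg m score) by [].
lra.
Qed.

Lemma avg_score m : avg m score = avg m block_score + delta m 0.
Proof.
have -> : delta m 0 = avg m score - avg m block_score by rewrite -avgB.
lra.
Qed.

Lemma avg_block_score n :
  avg n block_score = 2^-1 * \sum_(m < n) delta m 0.
Proof.
elim: n => [|n IH]; first by rewrite big_ord0 mulr0.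
by rewrite avg_block_scoreS IH big_ord_recr mulrDr.
Qed.

End BlockGain.

(** * Bounds for the growth per block *)

Lemma avg_ge_cst {R : realType} n (f : seq bool -> R) c :
  (forall w, c <= f w) -> c <= avg n f.
Proof. by move=> h; rewrite -[leLHS](avg_cst n); apply: ler_avg. Qed.

Lemma avg_le_cst {R : realType} n (f : seq bool -> R) c :
  (forall w, f w <= c) -> avg n f <= c.
Proof. by move=> h; rewrite -[leRHS](avg_cst n); apply: ler_avg. Qed.

Section Law.
Context {R : realType}.
Variables (k e : R).
Hypotheses (e_gt1 : 1 < e) (e_lt2 : e < 2) (ke : e * (k - e) = k).
Implicit Types (a b m n : nat) (eta c : R) (w : seq bool).

Local Notation eta_of := (eta_of k).
Local Notation omega := (omega k (k - 1)).

Lemma eta_of_le w : eta_of w <= e.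
Proof. by have /andP[] := eta_ofP e_gt1 e_lt2 ke w. Qed.

Lemma eta_of_gt0 w : 0 < eta_of w.
Proof. by have /andP[] := eta_ofP e_gt1 e_lt2 ke w. Qed.

Lemma eta_of_T_le a b c w : (0 < a)%N -> (0 < b)%N -> c <= e ->
  eta_of w <= blockmap k a b c -> eta_of (true :: w) <= blockmap k a.+1 b c.
Proof.
move=> a0 b0 ce h; rewrite -(blockmapS e_gt1 e_lt2 ke a0 b0 ce) eta_of_A.
have := blockmap_gt0 e_gt1 e_lt2 ke a0 b0 ce; have := eta_of_gt0 w.
move: h; set x := eta_of w; set y := blockmap _ _ _ _ => xy x0 y0.
have x1 : 0 < 1 + x by lra.
have y1 : 0 < 1 + y by lra.
by rewrite (ler_pdivrMr _ _ x1) mulrAC (ler_pdivlMr _ _ y1); move: xy; clear; lra.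
Qed.

Lemma eta_of_FT b w : (0 < b)%N ->
  eta_of (nseq b false ++ true :: w) = blockmap k 1 b (eta_of w).
Proof. by move=> b0; exact: (@eta_of_block _ k e e_gt1 e_lt2 ke 1 b w isT b0). Qed.

Lemma omega_ge w : - e <= omega w.
Proof.
have [k4 k2] := ke_gt e_gt1 e_lt2 ke; have e1 := e_gt1.
have := omega_cone e_gt1 e_lt2 ke w (cone_start k e_gt1).
by case: w => [|[] w]; lra.
Qed.

Lemma eta_of_F_le b w : (0 < b)%N ->
  eta_of (nseq b false ++ w) <= blockmap k 1 b e.
Proof.
case: b => // b _; rewrite [nseq _ _ ++ _]/= eta_of_B omega_nseqB /blockmap mul1r.
have := omega_ge w; have := @width_gt _ k e e_gt1 e_lt2 ke b.+1 e isT (lexx _).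
have -> : b.+1%:R * k = b%:R * k + k by rewrite -(natr1 b) mulrDl mul1r.
set n := b%:R * k; set u := omega w => h1 h2.
rewrite ler_pdivrMr; last by lra.
by rewrite mulrAC ler_pdivlMr; lra.
Qed.

Lemma eta_of_FT_ge w : blockmap k 1 1 0 <= eta_of (false :: true :: w).
Proof.
rewrite (@eta_of_FT 1 w isT); have e1 := e_gt1.
by apply: (blockmap_mono e_gt1 e_lt2 ke) => //; [exact/ltW/eta_of_gt0 | exact: eta_of_le].
Qed.

Lemma eta_of_F_ge1 w : 1 <= eta_of (false :: w).
Proof.
have := @omega_B _ k e e_gt1 e_lt2 ke 1 w isT; rewrite /= eta_of_B => h.
by rewrite ler_pdivlMr; lra.
Qed.

Variable f : R -> R.
Hypothesis f_mono : forall x y, 0 <= x -> x <= y -> y <= e -> f y <= f x.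

(** As [f] decreases, it suffices to bound [eta_of] above on each of the sixteen cylinders. Some
    leaves are coarser than four letters allow, such as [F 4 1 e] after AAAA. *)
Lemma avg_law_ge m :
  16^-1 * \sum_(l <- leaves (blockmap k) e) f l <=
  avg m.+4 (fun w => f (eta_of w)).
Proof.
have fle w c : eta_of w <= c -> c <= e -> f c <= f (eta_of w).
  by move=> h1 h2; apply: f_mono => //; exact/ltW/eta_of_gt0.
have B a b c : (0 < a)%N -> (0 < b)%N -> c <= e -> blockmap k a b c <= e.
  exact: (blockmap_le_e e_gt1 e_lt2 ke).
have fx := blockmap_fix e_gt1 e_lt2 ke.
(* With nothing known, the bound is [e = blockmap k 1 1 e]; each A read on the left then raises the
   first parameter by one. *)
have E1 w : eta_of w <= blockmap k 1 1 e by rewrite fx eta_of_le.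
have T2 w : eta_of (true :: w) <= blockmap k 2 1 e by exact: eta_of_T_le.
have T3 w : eta_of (true :: true :: w) <= blockmap k 3 1 e by exact: eta_of_T_le.
have T4 w : eta_of (true :: true :: true :: w) <= blockmap k 4 1 e.
  exact: eta_of_T_le.
have TFF w : eta_of (true :: false :: false :: w) <= blockmap k 2 2 e.
  by apply: eta_of_T_le => //; exact: (@eta_of_F_le 2).
have M b c d : (0 < b)%N -> c <= d -> d <= e ->
    blockmap k 1 b c <= blockmap k 1 b d.
  by move=> *; apply: (blockmap_mono e_gt1 e_lt2 ke).
have FT w c b : (0 < b)%N -> eta_of w <= c -> c <= e ->
    eta_of (nseq b false ++ true :: w) <= blockmap k 1 b c.
  by move=> b0 h1 h2; rewrite (eta_of_FT w b0); apply: M.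
have L : forall g c, (forall w, c <= g w) -> c <= avg m g by move=> g c; exact: avg_ge_cst.
rewrite /leaves !big_cons big_nil; cbn [avg].
have h1 := L _ _ (fun w => fle _ _ (T4 (true :: w)) (B 4%N 1%N e isT isT (lexx _))).
have h2 := L _ _ (fun w => fle _ _ (T4 (false :: w)) (B 4%N 1%N e isT isT (lexx _))).
have h3 := L _ _ (fun w => fle _ _ (T3 (false :: true :: w)) (B 3%N 1%N e isT isT (lexx _))).
have h4 := L _ _ (fun w => fle _ _ (T3 (false :: false :: w)) (B 3%N 1%N e isT isT (lexx _))).
have h5 := L _ _ (fun w => fle _ _ (T2 (false :: true :: true :: w)) (B 2%N 1%N e isT isT (lexx _))).
have h6 := L _ _ (fun w => fle _ _ (T2 (false :: true :: false :: w)) (B 2%N 1%N e isT isT (lexx _))).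
have h7 := L _ _ (fun w => fle _ _ (TFF (true :: w)) (B 2%N 2%N e isT isT (lexx _))).
have h8 := L _ _ (fun w => fle _ _ (TFF (false :: w)) (B 2%N 2%N e isT isT (lexx _))).
have b21 := B 2%N 1%N e isT isT (lexx _); have b12 := B 1%N 2%N e isT isT (lexx _).
have h9 := L _ _ (fun w => fle _ _ (@FT (true :: true :: w) _ 1%N isT (T2 _) b21) (B 1%N 1%N _ isT isT b21)).
have h10 := L _ _ (fun w => fle _ _ (@FT (true :: false :: w) _ 1%N isT (T2 _) b21) (B 1%N 1%N _ isT isT b21)).
(* After BABA two blocks with [a = b = 1] would act on the bound [e], which they fix. *)
have h11 := L _ _ (fun w => fle (false :: true :: false :: true :: w) e (eta_of_le _) (lexx _)).
have h12 := L _ _ (fun w => fle _ _ (@FT (false :: false :: w) _ 1%N isT (@eta_of_F_le 2 w isT) b12) (B 1%N 1%N _ isT isT b12)).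
have h13 := L _ _ (fun w => fle _ _ (@eta_of_F_le 2 (true :: true :: w) isT) b12).
have h14 := L _ _ (fun w => fle _ _ (@eta_of_F_le 2 (true :: false :: w) isT) b12).
have h15 := L _ _ (fun w => fle _ _ (@eta_of_F_le 3 (true :: w) isT) (B 1%N 3%N e isT isT (lexx _))).
have h16 := L _ _ (fun w => fle _ _ (@eta_of_F_le 3 (false :: w) isT) (B 1%N 3%N e isT isT (lexx _))).
cbn [nseq cat ncons iter] in h1, h9, h10, h12, h13, h14, h15, h16.
lra.
Qed.

(** The lower bounds for [eta_of] are 0 after AA and AB, [blockmap k 1 1 0] after BA and 1 after BB.
    They are the values behind [psioo] with index 3, 4, 1 and 2. *)
Lemma avg_law_le m : avg m.+2 (fun w => f (eta_of w)) <=
  4^-1 * (f (blockmap k 1 1 0) + f 1 + (f 0 + f 0)).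
Proof.
have e1 := e_gt1; have [k4 k2] := ke_gt e_gt1 e_lt2 ke.
have fge w c : 0 <= c -> c <= eta_of w -> f (eta_of w) <= f c.
  by move=> h1 h2; apply: f_mono => //; exact: eta_of_le.
have L : forall g c, (forall w, g w <= c) -> avg m g <= c by move=> g c; exact: avg_le_cst.
have h1 := L _ _ (fun w => fge (true :: true :: w) 0 (lexx _) (ltW (eta_of_gt0 _))).
have h2 := L _ _ (fun w => fge (true :: false :: w) 0 (lexx _) (ltW (eta_of_gt0 _))).
have p0 : 0 <= blockmap k 1 1 0.
  by apply/ltW/(blockmap_gt0 e_gt1 e_lt2 ke) => //; lra.
have h3 := L _ _ (fun w => fge _ _ p0 (eta_of_FT_ge w)).
have h4 := L _ _ (fun w => fge _ _ ler01 (eta_of_F_ge1 (false :: w))).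
cbn [avg]; lra.
Qed.

End Law.

(** * Growth of the score from below *)

Section LowerBound.
Context {R : realType}.
Variables (k e : R).
Hypotheses (e_gt1 : 1 < e) (e_lt2 : e < 2) (ke : e * (k - e) = k).
Variable N : R -> R.
Hypothesis N_ge0 : forall eta, 0 <= eta <= e -> 0 <= N eta.
Hypothesis gain_ge0 : forall a b eta, (0 < a)%N -> (0 < b)%N ->
  0 <= eta <= e -> 0 <= block_gain k N a b eta.
Variable ell : nat -> nat -> R.
Hypothesis ell_ge0 : forall a b, (0 < a)%N -> (0 < b)%N -> 0 <= ell a b.
Hypothesis ell_le : forall a b m, (0 < a)%N -> (0 < b)%N ->
  ell a b <= avg m.+4 (fun w => block_gain k N a b (eta_of k w)).

(** Each of [n] letters ends the run of B, leaving the four letters that [ell_le] requires, or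
    lengthens it. The event that the run is still open after [n] letters contributes a nonnegative
    term, which is dropped. *)
Lemma gain_ge n m a b : (0 < a)%N -> (0 < b)%N ->
  \sum_(j < n) 2^-1 ^+ j.+1 * ell a (b + j)%N <= gain k N (n + m.+4) a b.
Proof.
move=> a0; elim: n b => [|n IH] b b0.
  by rewrite big_ord0 (gain_avg_ge0 e_gt1 e_lt2 ke N_ge0 gain_ge0).
rewrite addSn (gainS e_gt1 e_lt2 ke N _ a0 b0) big_ord_recl addn0 expr1.
have H := IH b.+1 isT; have H2 := @ell_le a b (n + m) a0 b0.
rewrite -!addnS in H2.
have -> : \sum_(i < n) 2^-1 ^+ (bump 0 i).+1 * ell a (b + bump 0 i)%N =
    2^-1 * \sum_(j < n) 2^-1 ^+ j.+1 * ell a (b.+1 + j)%N.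
  by rewrite mulr_sumr; apply: eq_bigr => j _; rewrite /bump /= add1n exprS -mulrA addSnnS.
lra.
Qed.

Lemma delta_ge n m Q a : (0 < a)%N ->
  \sum_(i < n) 2^-1 ^+ i.+1 * \sum_(j < Q) 2^-1 ^+ j.+1 * ell (a + i)%N (1 + j)%N <=
  delta k N (n + (Q + m.+4)) a.
Proof.
elim: n a => [|n IH] a a0.
  by rewrite big_ord0 (delta_ge0 e_gt1 e_lt2 ke N_ge0 gain_ge0).
rewrite addSn deltaS big_ord_recl addn0 expr1.
have H := IH a.+1 isT; have H2 := @gain_ge Q (n + m) a 1 a0 isT.
have E : (n + (Q + m.+4) = Q + (n + m).+4)%N by lia.
rewrite -E in H2.
have -> : \sum_(i < n) 2^-1 ^+ (bump 0 i).+1 *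
    (\sum_(j < Q) 2^-1 ^+ j.+1 * ell (a + bump 0 i)%N (1 + j)%N) =
    2^-1 * \sum_(i < n) 2^-1 ^+ i.+1 *
      (\sum_(j < Q) 2^-1 ^+ j.+1 * ell (a.+1 + i)%N (1 + j)%N).
  by rewrite mulr_sumr; apply: eq_bigr => j _; rewrite /bump /= add1n exprS -mulrA addSnnS.
lra.
Qed.

(** The [Q + Q + 5] lost positions are [Q] letters for each of the two runs, four for the law of the
    direction and one for the first A of the block. The [delta] terms there are nonnegative. *)
Lemma avg_score_ge n Q :
  4^-1 * (n%:R - (Q + Q + 5)%:R) *
  (\sum_(i < Q) 2^-1 ^+ i.+1 * \sum_(j < Q) 2^-1 ^+ j.+1 * ell i.+1 j.+1) <=
  avg n (score k N).
Proof.
set p := \sum_(i < Q) _.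
have p0 : 0 <= p.
  apply: sumr_ge0 => i _; apply: mulr_ge0; first by rewrite exprn_ge0 // invr_ge0.
  apply: sumr_ge0 => j _; apply: mulr_ge0; last exact: ell_ge0.
  by rewrite exprn_ge0 // invr_ge0.
have d0 m : 0 <= delta k N m 0 by exact: (delta_ge0 e_gt1 e_lt2 ke N_ge0 gain_ge0).
have dm m : 2^-1 * p <= delta k N (Q + Q + 5 + m) 0.
  have -> : (Q + Q + 5 + m = (Q + (Q + m.+4)).+1)%N by lia.
  rewrite deltaS gain0 addr0; apply: ler_wpM2l => //.
  exact: (@delta_ge Q m Q 1 isT).
rewrite avg_score avg_block_score; apply: ler_wpDr => //.
have [le|/ltnW le] := leqP n (Q + Q + 5).
  apply: (@le_trans _ _ 0).
    by apply: mulr_le0_ge0 => //; apply: mulr_ge0_le0 => //; rewrite subr_le0 ler_nat.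
  by apply: mulr_ge0 => //; apply: sumr_ge0.
rewrite -natrB // -(subnKC le); set r := (n - _)%N.
rewrite addKn -(big_mkord xpredT (fun m => delta k N m 0)) (big_cat_nat (n := (Q + Q + 5)%N)) ?leq_addr //=.
have A0 : 0 <= \sum_(0 <= i < Q + Q + 5) delta k N i 0 by apply: sumr_ge0.
have : \sum_(0 <= i < r) 2^-1 * p <= \sum_(Q + Q + 5 <= i < Q + Q + 5 + r) delta k N i 0.
  rewrite -[X in _ <= \sum_(X <= i < _) _]add0n big_addn addKn.
  by apply: ler_sum => i _; rewrite [(i + _)%N]addnC.
by rewrite sumr_const_nat subn0 -mulr_natl; lra.
Qed.

End LowerBound.

(** * Growth of the score from above *)

Section UpperBound.
Context {R : realType}.
Variables (k e : R).
Hypotheses (e_gt1 : 1 < e) (e_lt2 : e < 2) (ke : e * (k - e) = k).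
Let N : R -> R := fun=> 0.
Variable u : nat -> nat -> R.
Hypothesis u_ge0 : forall a b, (0 < a)%N -> (0 < b)%N -> 0 <= u a b.
Hypothesis u_ge : forall a b m, (0 < a)%N -> (0 < b)%N ->
  avg m.+2 (fun w => block_gain k N a b (eta_of k w)) <= u a b.

Let N_ge0 eta : 0 <= eta <= e -> 0 <= N eta. Proof. by []. Qed.

Lemma nu_cst0 w : nu k N w = 0.
Proof. by elim: w => [//|[]]. Qed.

Lemma score_cst0 w : score k N w = logy k (k - 1) w.
Proof. by rewrite /score nu_cst0 addr0. Qed.

(** The linear growth of [omega] and [ln z <= z - 1] suffice here: in [gain_le] this bound only
    enters with the weight of runs that are still open near the end of the word. *)
Lemma gain_crude m a b : (0 < a)%N -> (0 < b)%N ->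
  gain k N m a b <= a%:R * (b%:R + m%:R + 1) * k.
Proof.
move=> a0 b0; have [k4 k2] := ke_gt e_gt1 e_lt2 ke; have e1 := e_gt1.
rewrite -[leRHS](avg_cst m); apply: ler_avg => w wm.
have h := omega_B e_gt1 e_lt2 ke w b0.
rewrite !score_cst0 (logy_nseqA _ h) logy_nseqB addrC addrA addNr add0r.
have a1 : 1 <= a%:R :> R by rewrite ler1n.
have ho : omega k (k - 1) w <= m.+1%:R * k.
  by rewrite -wm; apply: (omega_le e_gt1 e_lt2 ke); lra.
have au : omega k (k - 1) (nseq b false ++ w) <=
    a%:R * omega k (k - 1) (nseq b false ++ w) by rewrite ler_peMl //; lra.
have n1 : `|1 - a%:R * omega k (k - 1) (nseq b false ++ w)| =
    a%:R * omega k (k - 1) (nseq b false ++ w) - 1.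
  by rewrite distrC ger0_norm //; lra.
rewrite n1; apply: (le_trans (ln_le_subr1 _)); first by lra.
have : a%:R * omega k (k - 1) (nseq b false ++ w) <=
    a%:R * (b%:R + m%:R + 1) * k.
  rewrite -mulrA omega_nseqB; apply: ler_wpM2l; first by lra.
  by move: ho; rewrite -(natr1 m); lra.
lra.
Qed.

Let uS_ge0 n a b : (0 < a)%N -> (0 < b)%N ->
  0 <= \sum_(j < n) 2^-1 ^+ j.+1 * u a (b + j)%N.
Proof.
move=> a0 b0; apply: sumr_ge0 => j _; apply: mulr_ge0.
  by rewrite exprn_ge0 // invr_ge0.
by apply: u_ge0 => //; rewrite addn_gt0 b0.
Qed.

Lemma gain_le m a b : (0 < a)%N -> (0 < b)%N ->
  gain k N m a b <= \sum_(j < m) 2^-1 ^+ j.+1 * u a (b + j)%N +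
    2^-1 ^+ m * (4 * a%:R * (b%:R + m%:R + 3) * k).
Proof.
move=> a0; have [k4 k2] := ke_gt e_gt1 e_lt2 ke.
have a1 : 1 <= a%:R :> R by rewrite ler1n.
have ak : 0 < a%:R * k by apply: mulr_gt0; lra.
elim: m b => [|m IH] b b0.
  have b1 : 1 <= b%:R :> R by rewrite ler1n.
  apply: (le_trans (gain_crude 0 a0 b0)); rewrite big_ord0 expr0 add0r mul1r.
  have : 0 <= a%:R * k * (3 * b%:R + 11) by apply: mulr_ge0; lra.
  lra.
have b1 : 1 <= b%:R :> R by rewrite ler1n.
(* [u_ge] needs two unread letters beyond the one that ends the run, so lengths 1 and 2 use the
   crude bound; the factor 4 pays for [2^-2]. In the recursion [b + m] is constant, and the
   remainder reproduces itself exactly. *)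
case: m IH => [|[|m]] IH.
- apply: (le_trans (gain_crude 1 a0 b0)); rewrite expr1.
  have := uS_ge0 1 a0 b0.
  have : 0 <= a%:R * k * (b%:R + 6) by apply: mulr_ge0; lra.
  lra.
- apply: (le_trans (gain_crude 2 a0 b0)); rewrite expr2.
  have := uS_ge0 2 a0 b0.
  have : 0 <= a%:R * k by lra.
  lra.
rewrite (gainS e_gt1 e_lt2 ke N _ a0 b0) big_ord_recl addn0 expr1.
have H := IH b.+1 isT; have H2 := u_ge m a0 b0.
have -> : \sum_(i < m.+2) 2^-1 ^+ (bump 0 i).+1 * u a (b + bump 0 i)%N =
    2^-1 * \sum_(j < m.+2) 2^-1 ^+ j.+1 * u a (b.+1 + j)%N.
  by rewrite mulr_sumr; apply: eq_bigr => j _; rewrite /bump /= add1n exprS -mulrA addSnnS.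
rewrite [_ ^+ m.+3]exprS -(natr1 m.+2).
move: H; rewrite -(natr1 b); lra.
Qed.

Lemma delta_le m a : (0 < a)%N -> delta k N m a <=
  \sum_(i < m) 2^-1 ^+ i.+1 *
    (\sum_(j < m) 2^-1 ^+ j.+1 * u (a + i)%N (1 + j)%N) +
  2^-1 ^+ m * ((m%:R + 1) * (a%:R + m%:R + 4) ^+ 2 * k).
Proof.
have [k4 k2] := ke_gt e_gt1 e_lt2 ke.
elim: m a => [|m IH] a a0.
  have a1 : 1 <= a%:R :> R by rewrite ler1n.
  rewrite big_ord0 expr0 add0r mul1r /delta /= cats0 score_cst0 subr0.
  have E := @logy_nseqA _ k (k - 1) [::] a; rewrite cats0 /= add0r in E.
  rewrite E; last by lra.
  have p : 0 <= (a%:R - 1) * (k - 1) by apply: mulr_ge0; lra.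
  rewrite distrC ger0_norm; last by lra.
  apply: (le_trans (ln_le_subr1 _)); first by lra.
  have : 0 <= k * (a%:R ^+ 2 + 7 * a%:R + 16).
    by apply: mulr_ge0; rewrite ?addr_ge0 ?mulr_ge0 ?sqr_ge0; lra.
  lra.
rewrite deltaS.
have H := IH a.+1 isT; have H2 := @gain_le m a 1 a0 isT.
set S := \sum_(i < m.+1) _.
have HS : 2^-1 * (\sum_(i < m) 2^-1 ^+ i.+1 *
    (\sum_(j < m) 2^-1 ^+ j.+1 * u (a.+1 + i)%N (1 + j)%N)) +
    2^-1 * (\sum_(j < m) 2^-1 ^+ j.+1 * u a (1 + j)%N) <= S.
  have le a' : (0 < a')%N -> \sum_(j < m) 2^-1 ^+ j.+1 * u a' (1 + j)%N <=
      \sum_(j < m.+1) 2^-1 ^+ j.+1 * u a' (1 + j)%N.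
    move=> a'0; rewrite big_ord_recr /= lerDl mulr_ge0 ?u_ge0 //.
  rewrite /S big_ord_recl addn0 expr1 addrC; apply: lerD.
    by apply: ler_wpM2l => //; exact: le.
  rewrite mulr_sumr; apply: ler_sum => i _.
  rewrite [X in _ <= X]/= /bump leq0n add1n [_ ^+ i.+2]exprS -mulrA -addSnnS; apply: ler_wpM2l => //.
  by apply: ler_wpM2l; [rewrite exprn_ge0 // invr_ge0 | exact: le].
(* Here [a + m] is constant along the recursion. Raising the factor [m + 1] to [m + 2] absorbs the
   remainder of [gain_le], because [4 a (m + 5) <= (a + m + 5) ^ 2]. *)
have P : (m%:R + 1) * (a.+1%:R + m%:R + 4) ^+ 2 * k +
   4 * a%:R * (1 + m%:R + 3) * k <= (m.+1%:R + 1) * (a%:R + m.+1%:R + 4) ^+ 2 * k.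
  rewrite -!natr1 -mulrDl; apply: ler_wpM2r; first by lra.
  have := sqr_ge0 (a%:R - (m%:R + 5) : R).
  have : 0 <= a%:R :> R by rewrite ler0n.
  lra.
have q0 : 0 <= 2^-1 ^+ m :> R by rewrite exprn_ge0 ?invr_ge0.
have PP := ler_wpM2l q0 P.
rewrite [_ ^+ m.+1]exprS; lra.
Qed.

Variable U : R.
Hypothesis U_ge : forall n, \sum_(i < n) 2^-1 ^+ i.+1 *
    (\sum_(j < n) 2^-1 ^+ j.+1 * u i.+1 j.+1) <= U.

(** The remainder of [delta_le] is dominated by a difference of consecutive values of
    [2^-m * 4 (m + 8)^3]. Summed over [m] it telescopes to at most the value [2048] at [m = 0]. *)
Lemma delta0_le m : delta k N m 0 <=
  2^-1 * U + (2^-1 ^+ m * (4 * (m%:R + 8) ^+ 3) -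
              2^-1 ^+ m.+1 * (4 * (m%:R + 9) ^+ 3)) * k.
Proof.
have [k4 k2] := ke_gt e_gt1 e_lt2 ke.
have U0 : 0 <= U by have := U_ge 0; rewrite big_ord0.
case: m => [|m].
  rewrite /delta /= !score_cst0 /= subrr expr0 expr1.
  have : 0 <= U by []. lra.
rewrite deltaS gain0 addr0 [_ ^+ m.+2]exprS -(natr1 m).
have := @delta_le m 1 isT; have := U_ge m.
have -> : \sum_(i < m) 2^-1 ^+ i.+1 *
    (\sum_(j < m) 2^-1 ^+ j.+1 * u (1 + i)%N (1 + j)%N) =
  \sum_(i < m) 2^-1 ^+ i.+1 * (\sum_(j < m) 2^-1 ^+ j.+1 * u i.+1 j.+1) by [].
move=> h1 h2.
rewrite [_ ^+ m.+1]exprS.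
set z : R := m%:R in h2 *; set q : R := 2^-1 ^+ m in h2 *.
have z0 : 0 <= z by rewrite ler0n.
have q0 : 0 <= q by rewrite exprn_ge0 // invr_ge0.
have : (z + 1) * (1 + z + 4) ^+ 2 <=
    4 * (z + 1 + 8) ^+ 3 - 2^-1 * (4 * (z + 1 + 9) ^+ 3).
  have : 0 <= z ^+ 2 by rewrite sqr_ge0.
  have : 0 <= z ^+ 3 by rewrite exprn_ge0.
  lra.
move=> p; have qk : 0 <= q * k by apply: mulr_ge0; lra.
have := ler_wpM2l qk p; lra.
Qed.

Lemma avg_score_le n : avg n (score k N) <= 4^-1 * n%:R * U + 2^-1 * U + 4096 * k.
Proof.
have [k4 k2] := ke_gt e_gt1 e_lt2 ke.
have U0 : 0 <= U by have := U_ge 0; rewrite big_ord0.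
have pos (i j : nat) : 0 <= 2^-1 ^+ i * (4 * (j%:R + 8) ^+ 3) :> R.
  by rewrite !mulr_ge0 ?exprn_ge0 ?invr_ge0 ?addr_ge0.
rewrite avg_score avg_block_score.
have S : \sum_(m < n) delta k N m 0 <= n%:R * (2^-1 * U) +
    (2048 - 2^-1 ^+ n * (4 * (n%:R + 8) ^+ 3)) * k.
  elim: n => [|n IH]; first by rewrite big_ord0 expr0; lra.
  rewrite big_ord_recr /= -(natr1 n); have := delta0_le n.
  rewrite -addrA (_ : 1 + 8 = 9 :> R); first lra.
  by rewrite -[1]/(1%:R) -natrD.
have := delta0_le n; have := pos n n; have := pos n.+1 n.+1.
have b : 2^-1 ^+ n * (4 * (n%:R + 8) ^+ 3) <= 2048 :> R.
  elim: n {S} => [|n IH]; first by rewrite expr0; lra.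
  rewrite exprS -(natr1 n); apply: (le_trans _ IH).
  have q0 : 0 <= 2^-1 ^+ n :> R by rewrite exprn_ge0 ?invr_ge0.
  have P : 2^-1 * (4 * (n%:R + 1 + 8) ^+ 3) <= 4 * (n%:R + 8) ^+ 3 :> R.
    have z0 : 0 <= n%:R :> R by rewrite ler0n.
    have : 0 <= n%:R ^+ 2 :> R by rewrite sqr_ge0.
    have : 0 <= n%:R ^+ 3 :> R by rewrite exprn_ge0.
    lra.
  by have := ler_wpM2l q0 P; lra.
rewrite -(natr1 n) -addrA (_ : 1 + 8 = 9 :> R); last by rewrite -[1]/(1%:R) -natrD.
set x := 2^-1 ^+ n * _ in b S *; set y := 2^-1 ^+ n.+1 * _ => y0 x0 d.
have kk : 0 <= k by lra.
have yk := mulr_ge0 y0 kk; have xk := mulr_ge0 x0 kk.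
have : 0 <= (2048 - x) * k by apply: mulr_ge0; lra.
lra.
Qed.

End UpperBound.

(** * Expectations and matrix norms *)

Fixpoint words (n : nat) : seq (seq bool) :=
  if n is n'.+1 then map (cons true) (words n') ++ map (cons false) (words n')
  else [:: [::]].

Lemma mem_words n w : (w \in words n) = (size w == n).
Proof.
elim: n w => [|n IH] [|c w] //=.
  by rewrite mem_cat; apply/negP => /orP[] /mapP[].
rewrite mem_cat eqSS -IH; apply/orP/idP => [[] /mapP[v vn [_ ->]] //|wn].
by case: c; [left|right]; apply: map_f.
Qed.

Lemma words_uniq n : uniq (words n).
Proof.
elim: n => [//|n IH] /=; rewrite cat_uniq !map_inj_uniq ?IH //=; last first.
- by move=> u v [].
- by move=> u v [].
by rewrite andbT; apply/hasP => -[w /mapP[v _ ->] /mapP[]].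
Qed.

Lemma avg_words {R : realType} n (f : seq bool -> R) :
  avg n f = \sum_(u <- words n) 2^-1 ^+ n * f u.
Proof.
elim: n f => [|n IH] f /=; first by rewrite big_seq1 expr0 mul1r.
rewrite !IH big_cat !big_map mulrDr !mulr_sumr.
by congr (_ + _); apply: eq_bigr => u _; rewrite exprS mulrA.
Qed.

Section Expectation.
Context {R : realType} {d : measure_display} {T : measurableType d}.
Context {P : probability T R}.
Variable i : nat -> {RV P >-> bool}.
Hypothesis iid_i : iid_fair_bits i.

Definition word N (w : T) : seq bool := [seq i k w | k <- iota 0 N].

Let cylinder (u : seq bool) : set T :=
  \bigcap_(k in [set` iota 0 (size u)]) (i k @^-1` [set nth true u k]).

Lemma cylinderP N u w : size u = N -> (cylinder u w) <-> (word N w = u).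
Proof.
move=> <-; split => [h|<- k /=].
  apply: (@eq_from_nth _ true); rewrite size_map size_iota // => k ku.
  rewrite (nth_map 0%N) ?size_iota // nth_iota // add0n.
  by apply: (h k); rewrite /= mem_iota.
rewrite size_map size_iota mem_iota add0n => /andP[_ ku].
by rewrite /= (nth_map 0%N) ?size_iota // nth_iota // add0n.
Qed.

Lemma measurable_cylinder u : measurable (cylinder u).
Proof.
rewrite /cylinder; apply: fin_bigcap_measurable; first exact: finite_seq.
move=> k _; rewrite -[X in measurable X]setTI.
exact: (measurable_funPT (i k)).
Qed.

Lemma probability_cylinder u : P (cylinder u) = (2^-1 ^+ size u)%:E.
Proof.
have [indep fair] := iid_i.
rewrite /cylinder (indep (iota 0 (size u)) (fun k => [set nth true u k])) ?iota_uniq //.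
rewrite (eq_bigr (fun=> (2^-1)%:E)) => [|k _]; last exact: fair.
by rewrite prodEFin big_const_seq count_predT size_iota iter_mulr_1.
Qed.

(** The words of length [N] partition the space into cylinders, each of probability [2^-N] by
    independence. *)
Lemma expectation_word N (f : seq bool -> R) :
  'E_P[fun w => f (word N w)]%E = (avg N f)%:E.
Proof.
have decomp w : f (word N w) = \sum_(u <- words N) f u * \1_(cylinder u) w.
  have wN : word N w \in words N by rewrite mem_words size_map size_iota.
  rewrite (bigD1_seq _ wN (words_uniq N)) /= big_seq_cond big1 ?addr0.
    rewrite indicE mem_set ?mulr1 //.
    by apply/(@cylinderP N); rewrite ?size_map ?size_iota.
  move=> u /andP[uN /eqP nu]; rewrite indicE memNset ?mulr0 // => h.
  apply: nu; apply/esym/(@cylinderP N) => //.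
  by apply/eqP; rewrite -mem_words.
rewrite unlock.
under eq_integral => w _ do rewrite decomp -sumEFin.
have I u : P.-integrable [set: T] (fun w => (f u * \1_(cylinder u) w)%:E).
  under eq_fun do rewrite EFinM.
  by apply: integrableZl => //; apply: integrable_indic; exact: measurable_cylinder.
rewrite integral_sum // avg_words -sumEFin big_seq [RHS]big_seq.
apply: eq_bigr => u; rewrite mem_words => /eqP uN.
under eq_integral do rewrite EFinM.
rewrite integralZl //; last by apply: integrable_indic; exact: measurable_cylinder.
rewrite integral_indic //; last exact: measurable_cylinder.
by rewrite setIT; rewrite [X in (_ * X)%E]probability_cylinder uN -EFinM mulrC.
Qed.

End Expectation.

Section MatrixNorm.
Context {R : realType}.
Implicit Types M : 'M[R]_2.

Lemma entry_le_norm M (p q : 'I_2) : `|M p q| <= `|M|.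
Proof.
rewrite [leRHS]mx_normrE.
exact: (@le_bigmax _ _ _ 0 (fun ij : 'I_2 * 'I_2 => `|M ij.1 ij.2|) (p, q)).
Qed.

Lemma norm_le_entries M c : 0 <= c -> (forall p q, `|M p q| <= c) -> `|M| <= c.
Proof. by move=> c0 h; rewrite [leLHS]mx_normrE; apply: bigmax_le => // -[p q] _. Qed.

Lemma mulmx2E M M' (p q : 'I_2) : (M *m M') p q = M p 0 * M' 0 q + M p 1 * M' 1 q.
Proof. by rewrite mxE big_ord_recl big_ord1; congr (_ + _ * M' _ _); [congr (M _ _)|]; apply/val_inj. Qed.

Lemma norm_mulmx_le M M' : `|M *m M'| <= 2 * `|M| * `|M'|.
Proof.
apply: norm_le_entries => [|p q]; first by rewrite !mulr_ge0.
rewrite mulmx2E; apply: (le_trans (ler_normD _ _)); rewrite !normrM.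
have h (x : 'I_2) : `|M p x| * `|M' x q| <= `|M| * `|M'|.
  by apply: ler_pM => //; exact: entry_le_norm.
by have := h 0; have := h 1; lra.
Qed.

(* Applied to a row of a product of shears, as an affine function of the starting
   direction: it never vanishes on the cone. *)
Lemma slope_le (p q c o : R) : c < o ->
  (forall x, c <= x -> p * x + q != 0) -> `|p| * (o - c) <= `|p * o + q|.
Proof.
move=> co h; rewrite leNgt; apply/negP => lt.
have p0 : p != 0.
  by apply/eqP => p0; move: lt; rewrite p0 normr0 !mul0r ltNge normr_ge0.
(* If the inequality failed, the zero [- q / p] would lie in the half-line from [c] upwards. *)
have : p * (- q / p) + q != 0.
  apply: h; have E : o - - q / p = (p * o + q) / p by field.
  have : o - - q / p <= `|(p * o + q) / p| by rewrite -E ler_norm.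
  rewrite normrM normfV; have pp : 0 < `|p| by rewrite normr_gt0.
  move: lt; rewrite (mulrC `|p|) -ltr_pdivrMr // => lt; lra.
by case/negP; apply/eqP; field.
Qed.

End MatrixNorm.

(** * Matrix norm and growth of one vector *)

Section WordMatrix.
Context {R : realType}.
Variables (alpha beta e : R).
Hypotheses (alpha_lt : alpha < -2) (beta_gt : 2 < beta).
Let s := - alpha.
Let k := s * beta.
Hypotheses (e_gt1 : 1 < e) (e_lt2 : e < 2) (ke : e * (k - e) = k).
Implicit Types (w : seq bool) (o : R).

Fixpoint wmx w : 'M[R]_2 :=
  if w is c :: w' then (if c then shearA alpha else shearB beta) *m wmx w'
  else 1%:M.

Lemma wmx_cat u v : wmx (u ++ v) = wmx u *m wmx v.
Proof. by elim: u => [|c u IH] /=; rewrite ?mul1mx // IH mulmxA. Qed.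

Let s2 : 2 < s. Proof. by rewrite /s; have := alpha_lt; lra. Qed.

Lemma shearAE (M : 'M[R]_2) q : ((shearA alpha *m M) 0 q = M 0 q) *
  ((shearA alpha *m M) 1 q = alpha * M 0 q + M 1 q).
Proof.
rewrite !mulmx2E /shearA !mxE /=.
by split; rewrite ?mulr0n ?mulr1n; ring.
Qed.

Lemma shearBE (M : 'M[R]_2) q : ((shearB beta *m M) 0 q = M 0 q + beta * M 1 q) *
  ((shearB beta *m M) 1 q = M 1 q).
Proof.
rewrite !mulmx2E /shearB !mxE /=.
by split; rewrite ?mulr0n ?mulr1n; ring.
Qed.

Let vx o w := wmx w 0 0 * (o / s) + wmx w 0 1.
Let vy o w := wmx w 1 0 * (o / s) + wmx w 1 1.

Lemma wmx_vector o w : k - e <= o ->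
  [/\ vy o w != 0, s * vx o w = omega k o w * vy o w
    & ln `|vy o w| = logy k o w].
Proof.
move=> ho; have s2' := s2; rewrite /vx /vy; elim: w => [|[] w [y0 xE lE]] /=.
- rewrite !mxE /= mul0r add0r mul1r addr0 oner_neq0 normr1 ln1; split=> //.
  by field; lra.
- rewrite !shearAE; have n1 := omega_neq1 e_gt1 e_lt2 ke w ho.
  set x := wmx w 0 0 * _ + _ in xE *; set y := wmx w 1 0 * _ + _ in y0 xE lE *.
  have -> : (alpha * wmx w 0 0 + wmx w 1 0) * (o / s) +
      (alpha * wmx w 0 1 + wmx w 1 1) = y * (1 - omega k o w).
    rewrite mulrBr mulr1 (mulrC y) -xE /x /y /s; ring.
  split; first by rewrite mulf_neq0.
    by rewrite xE; field.
  by rewrite normrM lnM ?posrE ?normr_gt0 // lE.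
- rewrite !shearBE.
  set x := wmx w 0 0 * _ + _ in xE *; set y := wmx w 1 0 * _ + _ in y0 xE lE *.
  split=> //.
  have -> : (wmx w 0 0 + beta * wmx w 1 0) * (o / s) +
      (wmx w 0 1 + beta * wmx w 1 1) = x + beta * y by rewrite /x /y; ring.
  by rewrite mulrDr xE /k; ring.
Qed.

Let o := k - 1.
Let ho : k - e < o. Proof. by rewrite /o; have := e_gt1; lra. Qed.

Lemma wmx_norm_gt0 w : 0 < `|wmx w|.
Proof.
rewrite normr_gt0; apply/eqP => w0.
have [/eqP y0 _ _] := wmx_vector w (ltW ho); apply: y0.
by rewrite /vy w0 !mxE mul0r addr0.
Qed.

Lemma logy_le_norm w : logy k o w <= ln `|wmx w| + ln k.
Proof.
have [k4 k2] := ke_gt e_gt1 e_lt2 ke; have s2' := s2.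
have [y0 _ <-] := wmx_vector w (ltW ho).
have w0 := wmx_norm_gt0 w.
rewrite -lnM ?posrE //; last by lra.
have k0 : 0 < k by lra.
have wk : 0 < `|wmx w| * k by exact: mulr_gt0.
rewrite ler_ln ?posrE ?normr_gt0 ?wk //.
apply: (le_trans (ler_normD _ _)); rewrite normrM.
have o0 : 0 <= o by rewrite /o; lra.
rewrite (ger0_norm (divr_ge0 _ _)) //; last by lra.
have h1 : `|wmx w 1 0| * (o / s) <= `|wmx w| * o.
  apply: ler_pM => //; [by apply: divr_ge0 => //; lra|exact: entry_le_norm|].
  by rewrite ler_pdivrMr ?ler_peMr; lra.
have := entry_le_norm (wmx w) 1 1; move: h1; rewrite /o; lra.
Qed.

(** [e - 1] is the distance from the start direction [k - 1] to the boundary [k - e] of the cone, by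
    which [slope_le] divides. *)
Definition norm_const : R := (1 + k * (e - 1)^-1) * s * k.

Lemma norm_const_gt0 : 0 < norm_const.
Proof.
have [k4 k2] := ke_gt e_gt1 e_lt2 ke; have s2' := s2; have e1 := e_gt1.
have : 0 <= k * (e - 1)^-1 by rewrite mulr_ge0 ?invr_ge0; lra.
have b2 := beta_gt; move=> h; rewrite /norm_const; apply: mulr_gt0; last by lra.
by apply: mulr_gt0; lra.
Qed.

(** A single vector inside the cone controls the matrix: each row, as an affine function of the
    start direction, has no zero on the cone, so [slope_le] bounds its coefficients by its value at
    [k - 1]. The factor [(size w).+1] allows for the growth of [x / y] under leading letters B; its
    logarithm vanishes in the rate. *)
Lemma norm_le_logy w :
  ln `|wmx w| <= logy k o w + (ln norm_const + ln (size w).+1%:R).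
Proof.
have [k4 k2] := ke_gt e_gt1 e_lt2 ke; have s2' := s2; have e1 := e_gt1.
have [y0 xE <-] := wmx_vector w (ltW ho).
have C0 := norm_const_gt0.
have n0 : 0 < (size w).+1%:R :> R by rewrite ltr0n.
have n1 : 1 <= (size w).+1%:R :> R by rewrite ler1n.
have Cn : 0 < norm_const * (size w).+1%:R by exact: mulr_gt0.
have yn0 : 0 < `|vy o w| by rewrite normr_gt0.
rewrite -lnM ?posrE // -lnM ?posrE //.
rewrite ler_ln ?posrE ?wmx_norm_gt0 ?(mulr_gt0 yn0 Cn) //.
set y := vy o w in y0 xE *; set n : R := (size w).+1%:R in n0 n1 *.
have yp : 0 < `|y| by rewrite normr_gt0.
have row (p : 'I_2) c : (forall x, k - e <= x -> wmx w p 0 * (x / s) + wmx w p 1 != 0) ->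
    `|wmx w p 0 * (o / s) + wmx w p 1| <= c ->
    forall q, `|wmx w p q| <= (1 + k * (e - 1)^-1) * s * c.
  move=> h hc q.
  have := @slope_le _ (wmx w p 0 / s) (wmx w p 1) _ _ ho.
  have -> : wmx w p 0 / s * o + wmx w p 1 = wmx w p 0 * (o / s) + wmx w p 1 by ring.
  have -> : o - (k - e) = e - 1 by rewrite /o; ring.
  move=> /(_ _)/wrap[x hx|]; first by rewrite -mulrA (mulrC _ x); exact: h.
  set P := wmx w p 0; set Q := wmx w p 1 in hc * => sl.
  have c0 : 0 <= c by apply: le_trans hc.
  have i0 : 0 < (e - 1)^-1 by rewrite invr_gt0; lra.
  have sP : `|P / s| <= c * (e - 1)^-1.
    rewrite -ler_pdivrMr ?invrK //; exact: (le_trans sl).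
  have ci : 0 <= c * (e - 1)^-1 by rewrite mulr_ge0 // ltW.
  have bP : `|P| <= c * (e - 1)^-1 * s.
    move: sP; rewrite normrM normfV (@ger0_norm _ s); last by lra.
    by rewrite ler_pdivrMr //; lra.
  have bQ : `|Q| <= c + c * (e - 1)^-1 * k.
    have -> : Q = (P * (o / s) + Q) - (P / s) * o by ring.
    apply: (le_trans (ler_normB _ _)); apply: lerD => //.
    rewrite normrM (@ger0_norm _ o); last by rewrite /o; lra.
    by apply: ler_pM => //; rewrite /o; lra.
  have p1 : 0 <= c * (s - 1) by apply: mulr_ge0; lra.
  have p2 : 0 <= c * (e - 1)^-1 * (k * (s - 1)) by apply: mulr_ge0 => //; apply: mulr_ge0; lra.
  have p3 : 0 <= c * (e - 1)^-1 * (s * (k - 1)) by apply: mulr_ge0 => //; apply: mulr_ge0; lra.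
  have p4 : 0 <= c * s by apply: mulr_ge0; lra.
  case: q => -[|[|//]] hq.
    have -> : Ordinal hq = 0 by exact/val_inj. by rewrite -/P; lra.
  have -> : Ordinal hq = 1 by exact/val_inj. by rewrite -/Q; lra.
have om : `|omega k o w| <= n * k.
  rewrite ler_norml; apply/andP; split.
    have := omega_ge e_gt1 e_lt2 ke w; rewrite -/o.
    have : 0 <= (n - 1) * k by apply: mulr_ge0; lra.
    by have := e_lt2; lra.
  by apply: (omega_le e_gt1 e_lt2 ke); rewrite /o; have := e_lt2; lra.
have sx : `|vx o w| <= k * n * `|y|.
  have -> : vx o w = omega k o w * y / s by rewrite -xE; field; lra.
  rewrite normrM normfV (@ger0_norm _ s); last by lra.
  rewrite ler_pdivrMr ?normrM; last by lra.
  have := ler_wpM2r (ltW yp) om.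
  have : 0 <= n * k * `|y| * (s - 1).
    by apply: mulr_ge0; [apply: mulr_ge0; [apply: mulr_ge0|]|]; lra.
  lra.
have sy : `|y| <= k * n * `|y|.
  rewrite -subr_ge0 -[X in _ - X]mul1r -mulrBl; apply: mulr_ge0; last exact: ltW.
  have : 0 <= (k - 1) * n by apply: mulr_ge0; lra.
  lra.
have bound p q : `|wmx w p q| <= (1 + k * (e - 1)^-1) * s * (k * n * `|y|).
  case: p => -[|[|//]] hp.
    have -> : Ordinal hp = 0 by exact/val_inj.
    apply: row sx _ => x hx; have [yx xx _] := wmx_vector w hx.
    apply/eqP => x0; move: xx; rewrite /vx x0 mulr0 => /esym/eqP.
    by rewrite mulf_eq0 (negbTE yx) orbF (negbTE (omega_neq0 e_gt1 e_lt2 ke w hx)).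
  have -> : Ordinal hp = 1 by exact/val_inj.
  by apply: row sy _ => x hx; have [yx _ _] := wmx_vector w hx.
have E : `|y| * (norm_const * n) = (1 + k * (e - 1)^-1) * s * (k * n * `|y|).
  by rewrite /norm_const; ring.
rewrite E; apply: norm_le_entries; last exact: bound.
rewrite -E; apply: mulr_ge0; [exact: ltW|apply: mulr_ge0; exact: ltW].
Qed.

End WordMatrix.

(** * Limits and double series *)

Section Limits.
Context {R : realType}.
Implicit Types (u v : nat -> R) (a b c : R).

Lemma near_large (e c : R) : 0 < e -> \forall n \near \oo, c <= e * n%:R.
Proof.
move=> e0; exists (Num.bound (c / e)) => // n /= hn.
have [c0|c0] := leP c 0; first by apply: (le_trans c0); rewrite mulr_ge0 ?(ltW e0).
rewrite mulrC -ler_pdivrMr //; apply: ltW.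
have := archi_boundP (ltW (divr_gt0 c0 e0)); move=> /lt_le_trans; apply.
by rewrite ler_nat.
Qed.

Lemma limn_linear_ge u a b : cvgn u ->
  (forall n, (0 < n)%N -> a * n%:R - b <= n%:R * u n) -> a <= limn u.
Proof.
move=> /cvgrPdist_lt cu h; rewrite leNgt; apply/negP => lt.
set e := (a - limn u) / 2; have e0 : 0 < e by rewrite divr_gt0 // subr_gt0.
near \oo => n.
have n0 : 0 < n%:R :> R by rewrite ltr0n; near: n; exists 1%N.
have un : u n < limn u + e.
  have : `|limn u - u n| < e by near: n; exact: cu.
  by rewrite ltr_norml => /andP[]; lra.
have bn : b + 1 <= e * n%:R by near: n; exact: near_large.
have aE : a * n%:R = (limn u + 2 * e) * n%:R by rewrite /e; field.
have h2 : n%:R * u n < n%:R * (limn u + e) by rewrite ltr_pM2l.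
have /h : (0 < n)%N by rewrite -(ltr0n R).
by rewrite aE; move: bn h2; clear; lra.
Unshelve. all: by end_near.
Qed.

Lemma limn_linear_le u a b : cvgn u ->
  (forall n, (0 < n)%N -> n%:R * u n <= a * n%:R + b) -> limn u <= a.
Proof.
move=> cu h.
have : - a <= limn (fun n => - u n).
  apply: (@limn_linear_ge _ _ b); first exact: is_cvgN.
  by move=> n n0; have := h n n0; lra.
by rewrite limN // lerN2.
Qed.

(** Fekete's lemma applied to the subadditive sequence [v + c]; the lower bound [m] makes the
    infimum of [(v n + c) / n] finite. *)
Lemma cvgn_subadditive v (c m : R) : 0 <= c -> (forall n, m <= v n) ->
  (forall i j, v (i + j)%N <= v i + v j + c) -> cvgn (fun n => n%:R^-1 * v n).
Proof.
move=> c0 mv sub.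
pose A := [set x | exists2 n, (0 < n)%N & x = n%:R^-1 * (v n + c)].
have A_lb : lbound A (- `|m|).
  move=> x [n n0 ->]; have n1 : 1 <= n%:R :> R by rewrite ler1n.
  rewrite mulrC ler_pdivlMr; last by lra.
  have : 0 <= `|m| * (n%:R - 1) by rewrite mulr_ge0 // subr_ge0.
  have := mv n; have := ler_norm (- m); rewrite normrN; lra.
have A_inf : has_inf A.
  by split; [exists (1%:R^-1 * (v 1%N + c)); exists 1%N | exists (- `|m|)].
set L := inf A.
have iter_sub n q : v (q * n)%N <= q%:R * (v n + c) + `|v 0%N|.
  elim: q => [|q IH]; first by rewrite mul0n mul0r add0r ler_norm.
  rewrite mulSn; apply: (le_trans (sub _ _)).
  by rewrite -(natr1 q); lra.
apply/cvg_ex; exists L; apply/cvgrPdist_lt => e e0.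
have e20 : 0 < e / 2 by rewrite divr_gt0.
have [x [n n0 ->] xL] := inf_adherent e20 A_inf.
have nr0 : 0 < n%:R :> R by rewrite ltr0n.
set B := \sum_(r < n) `|v r|.
set K := `|v n + c| + `|v 0%N| + B + c + 1.
near=> p.
have p0 : 0 < p%:R :> R by rewrite ltr0n; near: p; exists 1%N.
have pK : K <= e / 2 * p%:R by near: p; exact: near_large.
have Lp : L <= p%:R^-1 * (v p + c).
  by apply: (inf_lbound (ex_intro _ _ A_lb)); exists p => //; rewrite -(ltr0n R).
have B0 : 0 <= B by apply: sumr_ge0.
have n1 := normr_ge0 (v n + c); have n2 := normr_ge0 (v 0%N).
rewrite distrC ltr_distl; apply/andP; split.
  rewrite ltrBlDr; apply: (le_lt_trans Lp).
  rewrite mulrDr ltrD2l mulrC ltr_pdivrMr //; move: pK; rewrite /K; lra.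
rewrite mulrC ltr_pdivrMr //.
have [q [r [rn pE]]] : exists q r, (r < n)%N /\ p = (q * n + r)%N.
  by exists (p %/ n)%N, (p %% n)%N; split; [rewrite ltn_mod | exact: divn_eq].
have vr : v r <= B.
  rewrite /B (bigD1 (Ordinal rn)) //=; apply: (le_trans (ler_norm _)).
  by rewrite lerDl; apply: sumr_ge0.
have vp : v p <= q%:R * (v n + c) + `|v 0%N| + B + c.
  by rewrite pE; apply: (le_trans (sub _ _)); have := iter_sub n q; lra.
have qE : q%:R * n%:R = p%:R - r%:R :> R by rewrite pE natrD natrM; ring.
have qv : q%:R * (v n + c) <= p%:R * (n%:R^-1 * (v n + c)) + `|v n + c|.
  have -> : p%:R = q%:R * n%:R + r%:R :> R by rewrite qE; ring.
  rewrite mulrDl mulrA -(mulrA q%:R) divff ?gt_eqF // mulr1 -addrA lerDl.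
  have : - `|v n + c| <= r%:R * (n%:R^-1 * (v n + c)).
    rewrite mulrA; apply: (@le_trans _ _ (- (`|r%:R / n%:R * (v n + c)|))).
      rewrite lerN2 normrM ler_piMl // ger0_norm ?divr_ge0 // ler_pdivrMr // mul1r.
      by rewrite ler_nat ltnW.
    by rewrite lerNl; have := ler_norm (- (r%:R / n%:R * (v n + c))); rewrite normrN.
  lra.
have h : p%:R * (n%:R^-1 * (v n + c)) < p%:R * (L + e / 2) by rewrite ltr_pM2l.
move: pK; rewrite /K; lra.
Unshelve. all: by end_near.
Qed.

End Limits.

Section DoubleSeries.
Context {R : realType}.
Variable g : nat -> nat -> R.
Hypothesis g_ge0 : forall a b, (0 < a)%N -> (0 < b)%N -> 0 <= g a b.
Variable B : R.
Hypothesis g_le : forall Q,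
  \sum_(1 <= a < Q) \sum_(1 <= b < Q) g a b <= B.

Let row a n := \sum_(1 <= b < n) g a b.

Let row_ge0 a n : (0 < a)%N -> 0 <= row a n.
Proof. by move=> a0; rewrite /row big_nat; apply: sumr_ge0 => b /andP[b0 _]; exact: g_ge0. Qed.

Let row_mono a : (0 < a)%N -> nondecreasing_seq (row a).
Proof.
move=> a0; apply/nondecreasing_seqP => n; rewrite /row.
have [n0|n0] := posnP n; first by rewrite n0 !big_geq.
by rewrite big_nat_recr //= lerDl g_ge0.
Qed.

(** A rectangle lies in a square and the terms are nonnegative, so bounds on squares control the
    iterated limits. *)
Lemma rect_le m n : \sum_(1 <= a < m) row a n <= B.
Proof.
apply: (le_trans _ (g_le (maxn m n))).
apply: (@le_trans _ _ (\sum_(1 <= a < m) row a (maxn m n))).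
  rewrite big_nat [leRHS]big_nat; apply: ler_sum => a /andP[a0 _].
  by apply: row_mono => //; rewrite leq_maxr.
rewrite -/(row _ _); have [m1|m1] := leqP m 1.
  rewrite big_geq // big_nat; apply: sumr_ge0 => a /andP[a0 _]; exact: row_ge0.
rewrite [leRHS](big_cat_nat (n := m)) ?leq_maxl //=; last exact: ltnW.
rewrite lerDl big_nat; apply: sumr_ge0 => a /andP[ma _].
by apply: row_ge0; apply: leq_trans ma; exact: ltnW.
Qed.

Let row_cvg a : (0 < a)%N -> cvgn (row a).
Proof.
move=> a0; apply: nondecreasing_is_cvgn; first exact: row_mono.
exists B => _ [n _ <-]; apply: (le_trans _ (rect_le a.+1 n)).
rewrite big_nat_recr //= lerDr big_nat; apply: sumr_ge0 => c /andP[c0 _].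
exact: row_ge0.
Qed.

Let outer n := \sum_(1 <= a < n) limn (row a).

Let outer_cvg_to n : \sum_(1 <= a < n) row a m @[m --> \oo] --> outer n.
Proof.
rewrite /outer; elim: n => [|n IH].
  by rewrite big_geq //; under eq_fun do rewrite big_geq //; exact: cvg_cst.
have [->|n0] := posnP n.
  by rewrite big_geq //; under eq_fun do rewrite big_geq //; exact: cvg_cst.
rewrite big_nat_recr //=; under eq_fun do rewrite big_nat_recr //=.
by apply: cvgD => //; exact: row_cvg.
Qed.

Let outer_le n : outer n <= B.
Proof.
rewrite -(cvg_lim (@Rhausdorff R) (@outer_cvg_to n)).
apply: limr_le; first by apply/cvg_ex; exists (outer n); exact: outer_cvg_to.
by near=> m; exact: rect_le.
Unshelve. all: by end_near.
Qed.

Let lim_row_ge0 a : (0 < a)%N -> 0 <= limn (row a).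
Proof.
move=> a0; apply: limr_ge; first exact: row_cvg.
by near=> n; exact: row_ge0.
Unshelve. all: by end_near.
Qed.

Let outer_mono : nondecreasing_seq outer.
Proof.
apply/nondecreasing_seqP => n; rewrite /outer.
have [n0|n0] := posnP n; first by rewrite n0 !big_geq.
by rewrite big_nat_recr //= lerDl lim_row_ge0.
Qed.

Let outer_cvg : cvgn outer.
Proof.
apply: nondecreasing_is_cvgn; first exact: outer_mono.
by exists B => _ [n _ <-]; exact: outer_le.
Qed.

Lemma double_series_le :
  \big[+%R/0]_(1 <= a <oo) \big[+%R/0]_(1 <= b <oo) g a b <= B.
Proof.
apply: (limr_le outer_cvg); by near=> n; exact: outer_le.
Unshelve. all: by end_near.
Qed.

Lemma double_series_ge Q : \sum_(1 <= a < Q) \sum_(1 <= b < Q) g a b <=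
  \big[+%R/0]_(1 <= a <oo) \big[+%R/0]_(1 <= b <oo) g a b.
Proof.
apply: (@le_trans _ _ (outer Q)); last exact: nondecreasing_cvgn_le.
rewrite /outer big_nat [leRHS]big_nat; apply: ler_sum => a /andP[a0 _].
by apply: (nondecreasing_cvgn_le (row_mono a0)); exact: row_cvg.
Qed.

End DoubleSeries.

(** * The theorem *)

Section LawOfDirections.
Context {R : realType}.
Variables (k e : R).
Hypotheses (e_gt1 : 1 < e) (e_lt2 : e < 2) (ke : e * (k - e) = k).

Local Notation L := (leaves (blockmap k) e).
Local Notation T := (targets (blockmap k) e).

Let e1 : 0 < e - 1. Proof. by rewrite subr_gt0. Qed.
Let e2 : e - 1 <= 1. Proof. by have := e_lt2; lra. Qed.
Let eE : 1 + (e - 1) = e. Proof. by ring. Qed.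

Let kE : (1 + (e - 1)) ^+ 2 / (e - 1) = k.
Proof.
have e1' := e1; rewrite eE; apply: (canLR (mulfK _)); first by apply/eqP; lra.
by move: ke; lra.
Qed.

Let gap_ineq :
  ((\sum_(t <- T) (k - 1 - t) ^+ 2) / 4) ^+ 8 <= \prod_(l <- L) (k - 1 - l).
Proof. by have := gap_inequality e1 e2; rewrite kE eE. Qed.

Let norm1_ineq :
  (2 + (\sum_(l <- L) l) / 16) ^+ 2 * (\sum_(t <- T) (1 / (2 + t)) ^+ 2) <= 4.
Proof. by have := norm1_inequality e1 e2; rewrite kE eE. Qed.

Let norm2_ineq :
  (4 + (\sum_(l <- L) l ^+ 2) / 16) * (\sum_(t <- T) (1 / (4 + t ^+ 2))) <= 4.
Proof. by have := norm2_inequality e1 e2; rewrite kE eE. Qed.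

Let bm_itv a b c : (0 < a)%N -> (0 < b)%N -> c <= e -> 0 <= blockmap k a b c <= e.
Proof.
move=> a0 b0 ce; rewrite (blockmap_le_e e_gt1 e_lt2 ke) // andbT.
exact/ltW/(blockmap_gt0 e_gt1 e_lt2 ke).
Qed.

Lemma leaves_itv l : l \in L -> 0 <= l <= e.
Proof.
have e0 : 0 <= e <= e by have := e_gt1; rewrite lexx andbT; lra.
have le a b c : (0 < a)%N -> (0 < b)%N -> c <= e -> blockmap k a b c <= e.
  exact: (blockmap_le_e e_gt1 e_lt2 ke).
have h : all (fun l => 0 <= l <= e) L.
  by rewrite /leaves /all e0 !bm_itv // ?le.
by move=> /(allP h).
Qed.

Lemma targets_itv t : t \in T -> 0 <= t <= e.
Proof.
have e0 : 0 <= e <= e by have := e_gt1; rewrite lexx andbT; lra.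
have h : all (fun l => 0 <= l <= e) T by rewrite /targets /all e0 !bm_itv.
by move=> /(allP h).
Qed.

Let ek : e < k - 1. Proof. by have [] := ke_gt e_gt1 e_lt2 ke; have := e_lt2; lra. Qed.

Let L_itv l : l \in L -> 0 <= l < k - 1.
Proof. by move=> /leaves_itv/andP[-> /le_lt_trans ->]. Qed.

Let T_itv t : t \in T -> 0 <= t < k - 1.
Proof. by move=> /targets_itv/andP[-> /le_lt_trans ->]. Qed.

Definition law_mean_le (Phi : R -> R) := mean_le L T Phi.


Let bk_ge b : (0 < b)%N -> k <= b%:R * k.
Proof.
have [k4 _] := ke_gt e_gt1 e_lt2 ke.
by rewrite -(ler1n R) => b1; rewrite ler_peMl; lra.
Qed.

(** The function is [a (K - t)] with [K = b k - 1 / a], and [K >= k - 1] with equality at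
    [a = b = 1]. *)
Lemma law_mean_oo a b : (0 < a)%N -> (0 < b)%N ->
  law_mean_le (fun t => a%:R * (b%:R * k - t) - 1).
Proof.
move=> a0 b0; have a1 : 1 <= a%:R :> R by rewrite ler1n.
have bk1 := bk_ge b0.
have -> : (fun t => a%:R * (b%:R * k - t) - 1) =
    (fun t => a%:R * (b%:R * k - a%:R^-1 - t)).
  by apply/funext => t; field; lra.
have K : k - 1 <= b%:R * k - a%:R^-1.
  have : a%:R^-1 <= 1 :> R by rewrite invf_le1; lra.
  lra.
apply: mean_leZ => //; first by lra.
- by move=> l /L_itv/andP[_]; lra.
- by move=> l /T_itv/andP[_]; lra.
exact: (mean_le_gap _ _ L_itv T_itv gap_ineq).
Qed.

Lemma law_mean_1 a b sigma : (0 < a)%N -> (0 < b)%N -> 0 < sigma <= 2^-1 ->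
  law_mean_le (fun t => ((a%:R + sigma) * (b%:R * k - t) - 1) / (1 + sigma * t)).
Proof.
move=> a0 b0 s01; have /andP[s0 _] := s01.
have a1 : 1 <= a%:R :> R by rewrite ler1n.
have bk1 := bk_ge b0.
have -> : (fun t => ((a%:R + sigma) * (b%:R * k - t) - 1) / (1 + sigma * t)) =
    (fun t => (a%:R + sigma) * ((b%:R * k - (a%:R + sigma)^-1 - t) / (1 + sigma * t))).
  apply/funext => t; rewrite mulrA; congr (_ / _); field; lra.
have K : k - 1 <= b%:R * k - (a%:R + sigma)^-1.
  have : (a%:R + sigma)^-1 <= 1 :> R by rewrite invf_le1; lra.
  lra.
have P t : 0 <= t < k - 1 ->
    0 < (b%:R * k - (a%:R + sigma)^-1 - t) / (1 + sigma * t).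
  by move=> /andP[t0 tk]; have := mulr_ge0 (ltW s0) t0 => st; apply: divr_gt0; lra.
apply: mean_leZ => //; first by lra.
- by move=> l /L_itv/P.
- by move=> l /T_itv/P.
exact: (mean_le_norm1 _ _ L_itv T_itv gap_ineq norm1_ineq).
Qed.

Lemma law_mean_2 a b sigma : (0 < a)%N -> (0 < b)%N -> 0 < sigma <= 2^-1 ->
  law_mean_le (fun t => Num.sqrt (((sigma * (b%:R * k - t)) ^+ 2 +
    (a%:R * (b%:R * k - t) - 1) ^+ 2) / (1 + sigma ^+ 2 * t ^+ 2))).
Proof.
move=> a0 b0 s01; have /andP[s0 _] := s01.
have a1 : 1 <= a%:R :> R by rewrite ler1n.
have bk1 := bk_ge b0.
(* Completing the square in [w = b k - t] turns the numerator into
   [q ((w - a / q)^2 + (sigma / q)^2)]; the last square is the [tau] of [mean_le_norm2]. *)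
set q := a%:R ^+ 2 + sigma ^+ 2.
have qa : a%:R <= q.
  have := sqr_ge0 sigma; have : 0 <= a%:R * (a%:R - 1) :> R by apply: mulr_ge0; lra.
  by rewrite /q; lra.
have q0 : 0 < q by lra.
have -> : (fun t => Num.sqrt (((sigma * (b%:R * k - t)) ^+ 2 +
    (a%:R * (b%:R * k - t) - 1) ^+ 2) / (1 + sigma ^+ 2 * t ^+ 2))) =
    (fun t => Num.sqrt q * Num.sqrt (((b%:R * k - a%:R / q - t) ^+ 2 +
       (sigma / q) ^+ 2) / (1 + sigma ^+ 2 * t ^+ 2))).
  apply/funext => t.
  have -> : (sigma * (b%:R * k - t)) ^+ 2 + (a%:R * (b%:R * k - t) - 1) ^+ 2 =
      q * ((b%:R * k - a%:R / q - t) ^+ 2 + (sigma / q) ^+ 2).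
    by rewrite /q; field; rewrite -/q; lra.
  by rewrite -mulrA sqrtrM // ltW.
have K : k - 1 <= b%:R * k - a%:R / q.
  have : a%:R / q <= 1 by rewrite ler_pdivrMr // mul1r.
  lra.
have P t : 0 <= t < k - 1 -> 0 < Num.sqrt (((b%:R * k - a%:R / q - t) ^+ 2 +
       (sigma / q) ^+ 2) / (1 + sigma ^+ 2 * t ^+ 2)).
  move=> /andP[t0 tk]; rewrite sqrtr_gt0 divr_gt0 //.
    by rewrite ltr_wpDr ?sqr_ge0 // exprn_gt0; lra.
  by have := mulr_ge0 (sqr_ge0 sigma) (sqr_ge0 t); lra.
apply: mean_leZ => //; first by rewrite sqrtr_gt0.
- by move=> l /L_itv/P.
- by move=> l /T_itv/P.
by apply: (mean_le_norm2 _ _ L_itv T_itv gap_ineq norm2_ineq) => //; exact: sqr_ge0.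
Qed.

End LawOfDirections.

Lemma square_sum {R : realType} (f : nat -> nat -> R) Q :
  \sum_(1 <= a < Q.+1) \sum_(1 <= b < Q.+1) (2^-1 ^+ (a + b) * ln (f a b)) =
  \sum_(i < Q) 2^-1 ^+ i.+1 * \sum_(j < Q) 2^-1 ^+ j.+1 * ln (f i.+1 j.+1).
Proof.
rewrite big_add1 big_mkord /=; apply: eq_bigr => i _.
rewrite big_add1 big_mkord /= mulr_sumr; apply: eq_bigr => j _.
by rewrite exprD mulrA.
Qed.

(** * The exponent and the series *)

Section Lyapunov.
Context {R : realType} {d : measure_display} {T : measurableType d}.
Context {P : probability T R}.
Variable i : nat -> {RV P >-> bool}.
Variables (alpha beta e : R).
Hypothesis iid_i : iid_fair_bits i.
Hypotheses (alpha_lt : alpha < -2) (beta_gt : 2 < beta).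
Local Notation k := (- alpha * beta).
Hypotheses (e_gt1 : 1 < e) (e_lt2 : e < 2) (ke : e * (k - e) = k).

Let lnw (u : seq bool) : R := ln `|wmx alpha beta u|.

Lemma random_product_word n w :
  random_product i alpha beta n w = wmx alpha beta (word i n w).
Proof.
rewrite /random_product /word -(big_mkord xpredT
  (fun j => if i j w then shearA alpha else shearB beta)).
suff gen m : \prod_(m <= j < m + n) (if i j w then shearA alpha else shearB beta)
    = wmx alpha beta [seq i j w | j <- iota m n] by exact: (gen 0%N).
elim: n m => [|n IH] m; first by rewrite addn0 big_geq.
by rewrite addnS big_ltn ?ltnS ?leq_addr //= -addSn IH.
Qed.

Let rate (n : nat) : R := n%:R^-1 * avg n lnw.

Lemma lyapunovE : lyapunov i alpha beta = limn rate.
Proof.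
rewrite /lyapunov; congr (lim (_ @ \oo)); apply/funext => n.
rewrite /rate; congr (_ * _).
transitivity (fine 'E_P[fun w => lnw (word i n w)]%E).
  by congr (fine (expectation _ _)); apply/funext => w; rewrite random_product_word.
by rewrite expectation_word.
Qed.

Let logy0 := logy k (k - 1).

Lemma avg_logy_le n : avg n logy0 <= avg n lnw + ln k.
Proof.
rewrite -[ln k](avg_cst n) -avgD; apply: ler_avg => w _.
exact: (logy_le_norm alpha_lt e_gt1 e_lt2 ke).
Qed.

Lemma avg_logy_ge0 n : 0 <= avg n logy0.
Proof.
have [k4 k2] := ke_gt e_gt1 e_lt2 ke.
have d0 m a : 0 <= delta k (fun=> 0) m a.
  apply: (delta_ge0 e_gt1 e_lt2 ke) => // a' b eta a0 b0 /andP[_ he].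
  rewrite /block_gain subr0 addr0 ln_ge0 //.
  exact/ltW/(denom_gt e_gt1 e_lt2 ke).
rewrite -(eq_avg n (@score_cst0 _ k)) avg_score avg_block_score.
by rewrite addr_ge0 // mulr_ge0 // sumr_ge0.
Qed.

(** Convergence is what gives [limn] its meaning. The defect [ln 2] arises because the entry maximum
    norm is submultiplicative only up to a factor 2. *)
Lemma rate_cvg : cvgn rate.
Proof.
apply: (@cvgn_subadditive _ _ (ln 2) (- ln k)).
- by rewrite ln_ge0 // ler1n.
- by move=> n; have := avg_logy_le n; have := avg_logy_ge0 n; lra.
move=> m n; rewrite avg_cat.
have inner u : avg n (fun v => lnw u + lnw v + ln 2) = lnw u + (avg n lnw + ln 2).
  by rewrite !avgD !avg_cst addrA.
have -> : avg m lnw + avg n lnw + ln 2 =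
    avg m (fun u => avg n (fun v => lnw u + lnw v + ln 2)).
  by rewrite (eq_avg m inner) avgD avg_cst addrA.
apply: ler_avg => u _.
apply: ler_avg => v _; rewrite /lnw wmx_cat.
have p w := wmx_norm_gt0 alpha_lt e_gt1 e_lt2 ke w.
rewrite -!lnM ?posrE ?mulr_gt0 ?p //.
rewrite ler_ln ?posrE ?mulr_gt0 ?p -?wmx_cat ?p //.
by rewrite wmx_cat; apply: (le_trans (norm_mulmx_le _ _)); lra.
Qed.

Section Lower.
Variables (Phi : nat -> nat -> R -> R) (N : R -> R) (Nmax : R).
Hypothesis N_itv : forall eta, 0 <= eta <= e -> 0 <= N eta <= Nmax.
Hypothesis gainE : forall a b eta, (0 < a)%N -> (0 < b)%N -> 0 <= eta <= e ->
  block_gain k N a b eta = ln (Phi a b eta).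
Hypothesis Phi_ge1 : forall a b eta, (0 < a)%N -> (0 < b)%N -> 0 <= eta <= e ->
  1 <= Phi a b eta.
Hypothesis Phi_anti : forall a b x y, (0 < a)%N -> (0 < b)%N ->
  0 <= x -> x <= y -> y <= e -> Phi a b y <= Phi a b x.
Hypothesis Phi_mean : forall a b, (0 < a)%N -> (0 < b)%N ->
  law_mean_le k e (Phi a b).

Let c a b : R := 4^-1 * \sum_(t <- targets (blockmap k) e) Phi a b t.

(** For fixed [Q] the score grows at least linearly, with slope a quarter of the partial sum; [n]
    tends to infinity before [Q]. The bound [Nmax] makes the change of norm a bounded error. *)
Lemma log_series_le_lyapunov : log_series c <= 4 * lyapunov i alpha beta.
Proof.
have N0 eta : 0 <= eta <= e -> 0 <= N eta by move=> /N_itv/andP[].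
have G0 a b eta : (0 < a)%N -> (0 < b)%N -> 0 <= eta <= e ->
    0 <= block_gain k N a b eta.
  by move=> a0 b0 he; rewrite gainE // ln_ge0 // Phi_ge1.
have c1 a b : (0 < a)%N -> (0 < b)%N -> 1 <= c a b.
  move=> a0 b0; have h t : t \in targets (blockmap k) e -> 1 <= Phi a b t.
    by move=> /(targets_itv e_gt1 e_lt2 ke)/Phi_ge1; exact.
  have := ler_sum_mem h; rewrite sumr_cst (_ : size _ = 4%N) // /c; lra.
have l0 a b : (0 < a)%N -> (0 < b)%N -> 0 <= ln (c a b).
  by move=> a0 b0; rewrite ln_ge0 // c1.
have lle a b m : (0 < a)%N -> (0 < b)%N ->
    ln (c a b) <= avg m.+4 (fun w => block_gain k N a b (eta_of k w)).
  move=> a0 b0.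
  apply: (le_trans _ (@avg_law_ge _ k e e_gt1 e_lt2 ke (block_gain k N a b) _ m)); last first.
    move=> x y x0 xy ye; have xe := le_trans xy ye; have y0 := le_trans x0 xy.
    rewrite !gainE ?x0 ?y0 ?xe ?ye //.
    rewrite ler_ln ?posrE ?(lt_le_trans ltr01) ?Phi_ge1 ?x0 ?y0 ?xe ?ye //.
    exact: Phi_anti.
  apply: (le_trans (Phi_mean a0 b0)); rewrite ler_wpM2l ?invr_ge0 //.
  apply: ler_sum_mem => l lL; rewrite gainE //.
  exact: (leaves_itv e_gt1 e_lt2 ke).
have key Q : \sum_(x < Q) 2^-1 ^+ x.+1 * (\sum_(j < Q) 2^-1 ^+ j.+1 * ln (c x.+1 j.+1))
    <= 4 * lyapunov i alpha beta.
  set p := \sum_(x < Q) _.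
  suff : 4^-1 * p <= lyapunov i alpha beta by lra.
  rewrite lyapunovE.
  apply: (@limn_linear_ge _ _ _ (4^-1 * (Q + Q + 5)%:R * p + Nmax + ln k) rate_cvg).
  move=> n n0; rewrite /rate mulVKf; last by rewrite pnatr_eq0 -lt0n.
  have h1 := avg_score_ge e_gt1 e_lt2 ke N0 G0 l0 lle n Q.
  have h2 := avg_logy_le n.
  have h3 : avg n (score k N) <= avg n logy0 + Nmax.
    rewrite -[Nmax](avg_cst n) -avgD; apply: ler_avg => w _.
    rewrite /score lerD2l; elim: w => [|[] w IH] //=.
      have e0 : (0 : R) <= 0 <= e by apply/andP; split=> //; have := e_gt1; lra.
      by have /andP[] := N_itv e0; exact: le_trans.
    apply: (proj2 (andP (N_itv _))).
    by have /andP[/ltW -> ->] := eta_ofP e_gt1 e_lt2 ke w.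
  by move: h1; rewrite -/p; lra.
have sq Q : \sum_(1 <= a < Q) \sum_(1 <= b < Q) (2^-1 ^+ (a + b) * ln (c a b)) <=
    4 * lyapunov i alpha beta.
  case: Q => [|Q]; last by rewrite square_sum.
  by have := key 0%N; rewrite big_ord0 big_geq.
apply: double_series_le sq => a b a0 b0.
by rewrite mulr_ge0 ?exprn_ge0 ?invr_ge0 // l0.
Qed.

End Lower.

Lemma sum_geometric_arith n : \sum_(j < n) 2^-1 ^+ j.+1 * j.+1%:R <= 2 :> R.
Proof.
suff -> : \sum_(j < n) 2^-1 ^+ j.+1 * j.+1%:R = 2 - 2^-1 ^+ n * (n%:R + 2) :> R.
  by rewrite lerBlDr lerDl mulr_ge0 ?exprn_ge0 ?invr_ge0 ?addr_ge0.
elim: n => [|n IH]; first by rewrite big_ord0 expr0; ring.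
by rewrite big_ord_recr /= IH -(natr1 n) exprS; field.
Qed.

Lemma lyapunov_le : 4 * lyapunov i alpha beta <= Uboundoo alpha beta.
Proof.
have [k4 k2] := ke_gt e_gt1 e_lt2 ke.
pose phi a b (t : R) : R := a%:R * (b%:R * k - t) - 1.
pose c a b : R := 4^-1 * (phi a b (blockmap k 1 1 0) + phi a b 1 +
  (phi a b 0 + phi a b 0)).
have -> : Uboundoo alpha beta = log_series c.
  rewrite /Uboundoo; congr log_series; apply/funext => a; apply/funext => b.
  rewrite 3?big_ltn // big_nat1 /psioo /c /phi /blockmap /= !mul1r subr0.
  have ab : 1 + alpha * beta != 0 by apply/eqP; lra.
  congr (_ * _); field; rewrite ab andbT; apply/eqP; lra.
have e0 : 0 < e by have := e_gt1; lra.
have b11 : 0 <= blockmap k 1 1 0 <= e.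
  rewrite ltW ?(blockmap_gt0 e_gt1 e_lt2 ke) //= ?(blockmap_le_e e_gt1 e_lt2 ke) //; exact: ltW.
have ph a b t : (0 < a)%N -> (0 < b)%N -> 0 <= t <= e -> 1 < phi a b t.
  by move=> a0 b0 /andP[_ te]; exact: (denom_gt e_gt1 e_lt2 ke).
have i1 : (0 : R) <= 1 <= e by apply/andP; split=> //; exact: ltW.
have i0 : (0 : R) <= 0 <= e by apply/andP; split=> //; exact: ltW.
have c1 a b : (0 < a)%N -> (0 < b)%N -> 1 <= c a b.
  move=> a0 b0; have := ph a b _ a0 b0 b11; have := ph a b _ a0 b0 i1.
  by have := ph a b _ a0 b0 i0; rewrite /c; lra.
have u0 a b : (0 < a)%N -> (0 < b)%N -> 0 <= ln (c a b).
  by move=> a0 b0; rewrite ln_ge0 // c1.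
have uge a b m : (0 < a)%N -> (0 < b)%N ->
    avg m.+2 (fun w => block_gain k (fun=> 0) a b (eta_of k w)) <= ln (c a b).
  move=> a0 b0.
  have gE : block_gain k (fun=> 0) a b = (fun t => ln (phi a b t)).
    by apply/funext => t; rewrite /block_gain subr0 addr0.
  rewrite gE; apply: (le_trans (@avg_law_le _ k e e_gt1 e_lt2 ke (fun t => ln (phi a b t)) _ m)).
    move=> x y x0 xy ye; rewrite ler_ln ?posrE.
    - by rewrite /phi lerB // ler_wpM2l // lerB.
    - by apply: (lt_trans ltr01); apply: ph => //; rewrite ye (le_trans x0).
    - by apply: (lt_trans ltr01); apply: ph => //; rewrite x0 (le_trans xy).
  have cc : 0 < c a b by apply: (lt_le_trans ltr01); exact: c1.
  (* Jensen's inequality for the four values, through the tangent of [ln] at their mean [c a b]. *)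
  have tan t : 0 <= t <= e -> ln (phi a b t) <= ln (c a b) + (phi a b t / c a b - 1).
    by move=> te; apply: ln_le_tangent => //; apply: (lt_trans ltr01); exact: ph.
  have := tan _ b11; have := tan _ i1; have := tan _ i0.
  have : (phi a b (blockmap k 1 1 0) / c a b + phi a b 1 / c a b +
     (phi a b 0 / c a b + phi a b 0 / c a b)) = 4.
    have cE : phi a b (blockmap k 1 1 0) + phi a b 1 + (phi a b 0 + phi a b 0) =
        4 * c a b by rewrite /c; field.
    by rewrite -!mulrDl cE mulfK // gt_eqF.
  lra.
(* This crude bound makes the double series converge, so that its partial sums lie below its
   value. *)
have cB a b : (0 < a)%N -> (0 < b)%N -> ln (c a b) <= a%:R * (b%:R * k).
  move=> a0 b0; apply: (le_trans (ln_le_subr1 _)).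
    by apply: (lt_le_trans ltr01); exact: c1.
  have /andP[p0 _] := b11; have A0 : 0 <= a%:R :> R by [].
  have := mulr_ge0 A0 p0; rewrite /c /phi; lra.
have key Q : \sum_(x < Q) 2^-1 ^+ x.+1 * (\sum_(j < Q) 2^-1 ^+ j.+1 * ln (c x.+1 j.+1))
    <= 4 * k.
  apply: (@le_trans _ _ (\sum_(x < Q) (2^-1 ^+ x.+1 * x.+1%:R) * (2 * k))).
    apply: ler_sum => x _; rewrite -mulrA; apply: ler_wpM2l.
      by rewrite exprn_ge0 ?invr_ge0.
    apply: (@le_trans _ _ (\sum_(j < Q) (2^-1 ^+ j.+1 * j.+1%:R) * (x.+1%:R * k))).
      apply: ler_sum => j _; rewrite -mulrA; apply: ler_wpM2l.
        by rewrite exprn_ge0 ?invr_ge0.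
      by apply: (le_trans (cB _ _ _ _)) => //; rewrite mulrCA.
    have xk : 0 <= x.+1%:R * k by apply: mulr_ge0 => //; lra.
    by rewrite -mulr_suml; have := ler_wpM2r xk (sum_geometric_arith Q); lra.
  rewrite -mulr_suml; have := sum_geometric_arith Q; have : 0 <= 2 * k by lra.
  by move=> h1 h2; have := ler_wpM2r h1 h2; lra.
have sq Q : \sum_(1 <= a < Q) \sum_(1 <= b < Q) (2^-1 ^+ (a + b) * ln (c a b)) <= 4 * k.
  case: Q => [|Q]; last by rewrite square_sum.
  by rewrite big_geq //; lra.
have g0 a b : (0 < a)%N -> (0 < b)%N -> 0 <= 2^-1 ^+ (a + b) * ln (c a b).
  by move=> a0 b0; rewrite mulr_ge0 ?exprn_ge0 ?invr_ge0 // u0.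
set U := log_series c.
have U_ge n : \sum_(x < n) 2^-1 ^+ x.+1 *
    (\sum_(j < n) 2^-1 ^+ j.+1 * ln (c x.+1 j.+1)) <= U.
  by rewrite -(square_sum c); exact: (@double_series_ge _ (fun a b => 2^-1 ^+ (a + b) * ln (c a b)) g0 (4 * k) sq n.+1).
suff : lyapunov i alpha beta <= 4^-1 * U by lra.
(* [ln n <= n / r + ln r - 1] for every [r]. *)
have bound r : 1 <= r -> lyapunov i alpha beta <= 4^-1 * U + r^-1.
  move=> r1; rewrite lyapunovE; have r0 : 0 < r by lra.
  apply: (@limn_linear_le _ _ _ (2^-1 * U + 4096 * k + ln (norm_const alpha beta e)
     + ln r + r^-1) rate_cvg).
  move=> n n0; rewrite /rate mulVKf; last by rewrite pnatr_eq0 -lt0n.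
  have h1 := avg_score_le e_gt1 e_lt2 ke u0 uge U_ge n.
  rewrite (eq_avg n (@score_cst0 _ k)) in h1.
  have h2 : avg n lnw <= avg n logy0 + (ln (norm_const alpha beta e) + ln n.+1%:R).
    rewrite -[ln _ + _](avg_cst n) -avgD; apply: ler_avg => w wn; rewrite -wn.
    exact: (norm_le_logy alpha_lt beta_gt e_gt1 e_lt2 ke).
  have h3 : ln n.+1%:R <= ln r + (n.+1%:R / r - 1) by apply: ln_le_tangent.
  by move: h1 h2 h3; rewrite -(natr1 n) mulrDl mul1r; lra.
rewrite leNgt; apply/negP => lt.
set gap := lyapunov i alpha beta - 4^-1 * U.
have g : 0 < gap by rewrite subr_gt0.
have G0 : 0 < 2 / gap by exact: divr_gt0.
have h : lyapunov i alpha beta <= 4^-1 * U + (1 + 2 / gap)^-1 by apply: bound; lra.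
have h2 : (1 + 2 / gap)^-1 < gap.
  rewrite -[ltRHS]invrK ltf_pV2 ?posrE ?invr_gt0 //; last by lra.
  have gi : 0 < gap^-1 by rewrite invr_gt0.
  by move: gi; set z := gap^-1; clearbody z; lra.
have gE : gap = lyapunov i alpha beta - 4^-1 * U by [].
by move: h h2 gE; set z := (1 + 2 / gap)^-1; clearbody z gap; lra.
Qed.

End Lyapunov.

(** * The fixed direction [Gamma] *)

Section GammaEquation.
Context {R : realType}.
Variables (alpha beta : R).
Hypotheses (alpha_lt : alpha < -2) (beta_gt : 2 < beta).
Local Notation k := (- alpha * beta).
Local Notation e := (alpha * Gamma alpha beta).

(** [e] is the smaller root [k / 2 - sqrt (k^2 / 4 - k)] of [z^2 - k z + k]. This polynomial is 1 at
    [z = 1] and [4 - k < 0] at [z = 2]. *)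
Lemma Gamma_equation :
  [/\ 1 < e, e < 2 & e * (k - e) = k].
Proof.
have al := alpha_lt; have bl := beta_gt.
have k4 : 4 < k.
  have : 0 < (- alpha - 2) * (beta - 2) by apply: mulr_gt0; lra.
  lra.
set D := (beta / 2) ^+ 2 + beta / alpha.
have an : alpha != 0 by apply/eqP; lra.
have aD : alpha ^+ 2 * D = (k / 2) ^+ 2 - k by rewrite /D; field.
have a2 : 0 < alpha ^+ 2 by rewrite exprn_even_gt0.
have D0 : 0 < D.
  rewrite -(pmulr_rgt0 _ a2) aD.
  have : 0 < k * (k - 4) by apply: mulr_gt0; lra.
  lra.
set r := Num.sqrt D; have r0 : 0 <= r by exact: sqrtr_ge0.
have r2 : r ^+ 2 = D by rewrite sqr_sqrtr // ltW.
set q := - alpha * r.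
have q0 : 0 <= q by apply: mulr_ge0; lra.
have q2 : q ^+ 2 = (k / 2) ^+ 2 - k by rewrite /q exprMn sqrrN r2.
have eE : e = k / 2 - q by rewrite /Gamma -/D -/r /q; field.
have q1 : q < k / 2 - 1.
  rewrite -ltr_sqr ?nnegrE ?q2 //; last by lra.
  lra.
have q3 : k / 2 - 2 < q.
  rewrite -ltr_sqr ?nnegrE ?q2 //; last by lra.
  lra.
rewrite eE; split; [by lra|by lra|].
have -> : (k / 2 - q) * (k - (k / 2 - q)) = (k / 2) ^+ 2 - q ^+ 2 by field.
by rewrite q2; ring.
Qed.

(** [Gamma_ ma mb] is the ratio [x / y] for the image of [(Gamma, 1)] under [A^ma B^mb]; this
    translates it to the coordinate [eta]. *)
Lemma GammaE_ ma mb : Gamma_ ma mb alpha beta =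
  - ((- alpha)^-1 * blockmap k ma mb e).
Proof.
have an : - alpha != 0 by apply/eqP; have := alpha_lt; lra.
rewrite /Gamma_ /blockmap; set g := Gamma alpha beta.
have -> : g + mb%:R * beta = (- alpha)^-1 * (mb%:R * k - alpha * g).
  by field; rewrite -oppr_eq0.
set w := _ - alpha * g.
have -> : ma%:R * alpha * g + ma%:R * mb%:R * alpha * beta + 1 = - (ma%:R * w - 1).
  by rewrite /w; ring.
by rewrite [(- (_ - 1))^-1]invrN mulrN -mulrA.
Qed.

Lemma LboundE (phi : nat -> nat -> nat -> nat -> R -> R -> R)
    (Phi : nat -> nat -> R -> R) :
  (forall ma mb a b, phi ma mb a b alpha beta = Phi a b (blockmap k ma mb e)) ->
  Lbound phi alpha beta =
  log_series (fun a b => 4^-1 * \sum_(t <- targets (blockmap k) e) Phi a b t).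
Proof.
have [e1 e2 ke] := Gamma_equation => h.
rewrite /Lbound; congr log_series; apply/funext => a; apply/funext => b.
have two (F : nat -> R) : \sum_(1 <= m < 3) F m = F 1%N + F 2%N.
  by rewrite big_ltn // big_nat1.
rewrite !two /targets !big_cons big_nil !h (blockmap_fix e1 e2 ke) addr0.
by rewrite -!addrA.
Qed.

End GammaEquation.

Section Bounds.
Context {R : realType} {d : measure_display} {T : measurableType d}.
Context {P : probability T R}.
Variable i : nat -> {RV P >-> bool}.
Variables (alpha beta : R).
Hypothesis iid_i : iid_fair_bits i.
Hypotheses (alpha_lt : alpha < -2) (beta_gt : 2 < beta).
Local Notation k := (- alpha * beta).
Local Notation e := (alpha * Gamma alpha beta).
Local Notation sigma := ((- alpha)^-1).

Let e1 : 1 < e. Proof. by have [] := Gamma_equation alpha_lt beta_gt. Qed.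
Let e2 : e < 2. Proof. by have [] := Gamma_equation alpha_lt beta_gt. Qed.
Let ke : e * (k - e) = k. Proof. by have [] := Gamma_equation alpha_lt beta_gt. Qed.

Let sigma_itv : 0 < sigma <= 2^-1.
Proof.
have al := alpha_lt.
by apply/andP; split; [rewrite invr_gt0|rewrite lef_pV2 ?posrE]; lra.
Qed.

Let width a b eta : (0 < a)%N -> (0 < b)%N -> eta <= e ->
  [/\ 2 < b%:R * k - eta, 1 < a%:R * (b%:R * k - eta) - 1 & 1 <= a%:R :> R].
Proof.
by move=> a0 b0 he; rewrite (width_gt e1 e2 ke) // (denom_gt e1 e2 ke) // ler1n.
Qed.

Lemma Lbound_oo : Lbound phioo alpha beta <= 4 * lyapunov i alpha beta.
Proof.
have an : - alpha != 0 by apply/eqP; have := alpha_lt; lra.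
rewrite (@LboundE _ _ _ alpha_lt beta_gt _ (fun a b t => a%:R * (b%:R * k - t) - 1)).
  (* As [eta <= e < 2 < - alpha], the vector [(- eta / s, 1)] has maximum norm 1, hence [N = 0]. *)
  apply: (@log_series_le_lyapunov _ _ _ _ i _ _ _ iid_i alpha_lt e1 e2 ke _ (fun=> 0) 0).
  - by move=> *; rewrite lexx.
  - by move=> *; rewrite /block_gain subr0 addr0.
  - by move=> a b eta a0 b0 /andP[_ he]; have [_ /ltW] := width a0 b0 he.
  - by move=> a b x y _ _ _ xy _; rewrite lerB // ler_wpM2l // lerB.
  - by move=> a b a0 b0; exact: law_mean_oo.
move=> ma mb a b; rewrite /phioo GammaE_ //; field.
by rewrite -oppr_eq0.
Qed.

Lemma Lbound_1 : Lbound phi1 alpha beta <= 4 * lyapunov i alpha beta.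
Proof.
have an : - alpha != 0 by apply/eqP; have := alpha_lt; lra.
have /andP[s0 s1] := sigma_itv.
have e2' := e2; have e1' := e1.
have pos t : 0 <= t -> 0 < 1 + sigma * t.
  by move=> t0; have := mulr_ge0 (ltW s0) t0; lra.
rewrite (@LboundE _ _ _ alpha_lt beta_gt _
   (fun a b t => ((a%:R + sigma) * (b%:R * k - t) - 1) / (1 + sigma * t))).
  apply: (@log_series_le_lyapunov _ _ _ _ i _ _ _ iid_i alpha_lt e1 e2 ke _
    (fun t => ln (1 + sigma * t)) (sigma * e)).
  - move=> eta /andP[h0 he]; rewrite ln_ge0; last by have := mulr_ge0 (ltW s0) h0; lra.
    apply: (le_trans (ln_le_subr1 (pos _ h0))).
    by rewrite addrC addKr ler_wpM2l // ltW.
  - move=> a b eta a0 b0 /andP[h0 he]; have [w2 d1 a1] := width a0 b0 he.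
    have s0' := ltW s0; rewrite /block_gain -lnM ?posrE; last first.
    + by apply: pos; apply: divr_ge0; lra.
    + by lra.
    rewrite -ln_div ?pos //; last first.
      by apply: mulr_gt0; [lra | apply: pos; apply: divr_ge0; lra].
    congr (ln (_ / _)); rewrite /blockmap; set w := _ - eta in w2 d1 *.
    by set s := sigma; field; lra.
  - move=> a b eta a0 b0 /andP[h0 he]; have [w2 d1 a1] := width a0 b0 he.
    rewrite ler_pdivlMr ?pos //.
    (* With [w = b k - eta], numerator minus denominator is [(a w - 2) + sigma (w - eta)], and
       [w > 2 > eta]. *)
    have : 0 <= sigma * (b%:R * k - eta - eta) by apply: mulr_ge0; lra.
    lra.
  - move=> a b x y a0 b0 x0 xy ye.
    have xe := le_trans xy ye; have y0 := le_trans x0 xy.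
    have [w2 d1 a1] := width a0 b0 xe; have [w2' d1' _] := width a0 b0 ye.
    have sw : 0 <= sigma * (b%:R * k - y) by apply: mulr_ge0; lra.
    have sx : sigma * x <= sigma * y by rewrite ler_wpM2l // ltW.
    have px := pos _ x0; have py := pos _ y0.
    apply: ler_pM; rewrite ?invr_ge0 ?(ltW py) //; first by lra.
    + by rewrite lerD2r ler_wpM2l ?addr_ge0 ?(ltW s0) // lerB.
    + by rewrite lef_pV2 ?posrE // lerD2l.
  - by move=> a b a0 b0; exact: law_mean_1.
move=> ma mb a b; rewrite /phi1 GammaE_ // opprK mulrC.
congr (_ / _); field.
by rewrite -oppr_eq0.
Qed.

Lemma Lbound_2 : Lbound phi2 alpha beta <= 4 * lyapunov i alpha beta.
Proof.
have an : - alpha != 0 by apply/eqP; have := alpha_lt; lra.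
have /andP[s0 s1] := sigma_itv.
have e2' := e2; have e1' := e1.
have pos t : 0 < 1 + sigma ^+ 2 * t ^+ 2.
  by have := mulr_ge0 (sqr_ge0 sigma) (sqr_ge0 t); lra.
have lnsqrt (y : R) : 0 < y -> 2^-1 * ln y = ln (Num.sqrt y).
  move=> y0; rewrite -{1}[y]sqr_sqrtr ?(ltW y0) // lnXn ?sqrtr_gt0 //.
  by rewrite -mulr_natl; lra.
rewrite (@LboundE _ _ _ alpha_lt beta_gt _
   (fun a b t => Num.sqrt (((sigma * (b%:R * k - t)) ^+ 2 +
    (a%:R * (b%:R * k - t) - 1) ^+ 2) / (1 + sigma ^+ 2 * t ^+ 2)))).
  apply: (@log_series_le_lyapunov _ _ _ _ i _ _ _ iid_i alpha_lt e1 e2 ke _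
    (fun t => 2^-1 * ln (1 + sigma ^+ 2 * t ^+ 2)) (sigma ^+ 2 * e ^+ 2)).
  - move=> eta /andP[h0 he].
    have h1 : 0 <= ln (1 + sigma ^+ 2 * eta ^+ 2).
      by rewrite ln_ge0 //; have := mulr_ge0 (sqr_ge0 sigma) (sqr_ge0 eta); lra.
    have h2 := ln_le_subr1 (pos eta).
    have h3 : sigma ^+ 2 * eta ^+ 2 <= sigma ^+ 2 * e ^+ 2.
      by rewrite ler_wpM2l ?sqr_ge0 // lerXn2r ?nnegrE //; lra.
    by apply/andP; split; lra.
  - move=> a b eta a0 b0 /andP[h0 he]; have [w2 d1 a1] := width a0 b0 he.
    rewrite /block_gain !lnsqrt ?pos // -lnM ?posrE ?sqrtr_gt0 ?pos //; last by lra.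
    rewrite -ln_div ?sqrtr_gt0 ?pos ?mulr_gt0 ?sqrtr_gt0 ?pos //; last by lra.
    congr ln.
    have DE : a%:R * (b%:R * k - eta) - 1 =
        Num.sqrt ((a%:R * (b%:R * k - eta) - 1) ^+ 2).
      by rewrite sqrtr_sqr ger0_norm //; lra.
    rewrite {1}DE -sqrtrM ?sqr_ge0 // -sqrtrV ?(ltW (pos _)) // -sqrtrM; last first.
      by rewrite mulr_ge0 ?sqr_ge0 // ltW.
    congr (Num.sqrt (_ / _)); rewrite /blockmap; set w := _ - eta in w2 d1 *.
    by set s := sigma; field; lra.
  - move=> a b eta a0 b0 /andP[h0 he]; have [w2 d1 a1] := width a0 b0 he.
    rewrite -[leLHS]sqrtr1 ler_wsqrtr // ler_pdivlMr ?pos // mul1r addrC.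
    apply: lerD.
      rewrite -exprMn lerXn2r ?nnegrE ?mulr_ge0 ?(ltW s0) //; first by lra.
      by rewrite ler_wpM2l ?(ltW s0) //; lra.
    by rewrite -[leLHS](expr1n _ 2) lerXn2r ?nnegrE //; lra.
  - move=> a b x y a0 b0 x0 xy ye.
    have xe := le_trans xy ye; have y0 := le_trans x0 xy.
    have [w2 d1 a1] := width a0 b0 xe; have [w2' d1' _] := width a0 b0 ye.
    apply: ler_wsqrtr; apply: ler_pM.
    + by rewrite addr_ge0 ?sqr_ge0.
    + by rewrite invr_ge0 ltW.
    + apply: lerD; rewrite lerXn2r ?nnegrE ?mulr_ge0 ?(ltW s0) //; try lra.
        by rewrite ler_wpM2l ?(ltW s0) // lerB.
      by rewrite lerB // ler_wpM2l // lerB.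
    + by rewrite lef_pV2 ?posrE ?pos // lerD2l ler_wpM2l ?sqr_ge0 // lerXn2r ?nnegrE.
  - by move=> a b a0 b0; exact: law_mean_2.
move=> ma mb a b; rewrite /phi2 GammaE_ // mulrC.
congr (Num.sqrt (_ / _)); last by rewrite sqrrN exprMn.
by field; rewrite -oppr_eq0.
Qed.

End Bounds.

Theorem theorem5 (R : realType) (d : measure_display) (T : measurableType d)
    (P : probability T R) (i : nat -> {RV P >-> bool}) (alpha beta : R)
    (iid_i : iid_fair_bits i) (alpha_lt : alpha < -2) (beta_gt : 2 < beta) :
  Num.max (Num.max (Lbound phi1 alpha beta) (Lbound phi2 alpha beta))
    (Lbound phioo alpha beta) <= 4 * lyapunov i alpha beta /\
  4 * lyapunov i alpha beta <= Uboundoo alpha beta.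
Proof.
split; last first.
  have [e1 e2 ke] := Gamma_equation alpha_lt beta_gt.
  exact: (lyapunov_le iid_i alpha_lt beta_gt e1 e2 ke).
by rewrite !ge_max (Lbound_1 iid_i) // (Lbound_2 iid_i) // (Lbound_oo iid_i).
Qed.
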